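(* Let $r\in(0,\infty)$, let $P=f\cdot\lambda_d$ be an absolutely continuous Borel probability measure on $\mathbb{R}^d$ with $\int\|x\|^{r+\delta}\,dP(x)<+\infty$ for some $\delta>0$, and for every $n\ge1$ let $\alpha_n$ be an $L^r$-optimal $n$-quantizer for $P$. Assume that $$\kappa_f:=\inf_{x\in\mathrm{supp}(P),\,\rho>0}\frac{\lambda_d(\mathrm{supp}(P)\cap B(x,\rho))}{\lambda_d(B(x,\rho))}>0.$$ For $\varepsilon\ge0$, let $(G_\varepsilon)$ denote the condition: there exist real numbers $\eta\in(0,\frac12)$ and $M,C>0$ such that $$\forall\,x,y\in\mathrm{supp}(P),\quad \|x\|\ge M,\ \|y-x\|\le 2\eta\|x\|\ \Longrightarrow\ f(y)\ge C\,(f(x))^{1+\varepsilon}.$$ Suppose that $(G_\varepsilon)$ holds for some $\varepsilon\ge0$. Then for every $s\in\left(r,\frac{d+r}{1+\varepsilon}\right)$ such that $$\int_{\mathbb{R}^d}\frac{dP(x)}{(f(x))^{\frac{s(1+\varepsilon)}{d+r}}}<+\infty$$ (if any), one has $$\sup_n n^{s/d}\int d(x,\alpha_n)^s\,dP(x)<+\infty.\qquad(\ast)_s$$ In particular, if $(G_\varepsilon)$ holds either for $\varepsilon=0$ or for every $\varepsilon\in(0,\underline\varepsilon]$ for some $\underline\varepsilon>0$, and if $$\forall\,s\in(r,d+r),\qquad \int_{\mathbb{R}^d}\frac{dP(x)}{(f(x))^{\frac{s}{d+r}}}=\int_{\{f>0\}}(f(x))^{1-\frac{s}{d+r}}\,d\lambda_d(x)<+\infty,$$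 then $(\ast)_s$ holds for every $s\in(r,d+r)$.
   Context: $\mathbb{R}^d$ ($d\ge 1$) is equipped with an arbitrary norm $\|\cdot\|$; $d(x,A)=\inf_{a\in A}\|x-a\|$; $B(x,\rho)$ is the closed ball with center $x$ and radius $\rho$; $\lambda_d$ is Lebesgue measure. An $L^r$-optimal $n$-quantizer for $P$ is a nonempty set $\alpha\subset\mathbb{R}^d$ with $\mathrm{card}(\alpha)\le n$ minimizing $\int d(x,\alpha)^r\,dP(x)$ among all nonempty subsets of $\mathbb{R}^d$ of cardinality at most $n$. *)

(* Defs.v *)
(* MathComp-Analysis *)
From HB Require Import structures.
From mathcomp Require Import all_boot all_order all_algebra.
From mathcomp Require Import all_classical all_reals all_analysis.
From mathcomp Require Import measurable_realfun.

Set Implicit Arguments.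
Unset Strict Implicit.
Unset Printing Implicit Defensive.

Import Order.TTheory GRing.Theory Num.Theory.
Import numFieldNormedType.Exports.

Local Open Scope classical_set_scope.
Local Open Scope ring_scope.

(* The measurable sets of ['M[R]_(m, n)], hence of ['rV[R]_d], are the Borel
   sets. *)
HB.instance Definition _ (R : realType) (m n : nat) :=
  @isMeasurable.Build (sigma_display (@open 'M[R]_(m, n))) 'M[R]_(m, n)
    <<s @open 'M[R]_(m, n) >> (@sigma_algebra0 _ setT _)
    (@sigma_algebraC 'M[R]_(m, n) (@open 'M[R]_(m, n)))
    (@sigma_algebra_bigcup _ setT _).

Section image_measure.
Context d1 d2 (T1 : measurableType d1) (T2 : measurableType d2) (R : realType).
Local Open Scope ereal_scope.

Definition image_measure (mu : {measure set T1 -> \bar R}) (f : T1 -> T2)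
    (mf : measurable_fun [set: T1] f) : set T2 -> \bar R :=
  pushforward mu f.

Section measure.
Variables (mu : {measure set T1 -> \bar R}) (f : T1 -> T2).
Hypothesis mf : measurable_fun [set: T1] f.

Let image0 : image_measure mu mf set0 = 0.
Proof. by rewrite /image_measure /pushforward preimage_set0 measure0. Qed.

Let image_ge0 A : 0 <= image_measure mu mf A.
Proof. exact: measure_ge0. Qed.

Let image_sigma_additive : semi_sigma_additive (image_measure mu mf).
Proof.
move=> F mF tF mUF; rewrite /image_measure /pushforward preimage_bigcup.
apply: measure_semi_sigma_additive.
- by move=> n; rewrite -[X in measurable X]setTI; exact: mf.
- apply/trivIsetP => /= i j _ _ ij; rewrite -preimage_setI.
  by move/trivIsetP : tF => /(_ _ _ _ _ ij) ->//; rewrite preimage_set0.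
- by rewrite -preimage_bigcup -[X in measurable X]setTI; exact: mf.
Qed.

HB.instance Definition _ := isMeasure.Build _ _ _ (image_measure mu mf)
  image0 image_ge0 image_sigma_additive.

End measure.

Lemma image_measure_sigma_finite (mu : {measure set T1 -> \bar R})
    (f : T1 -> T2) (g : T2 -> T1) (mf : measurable_fun [set: T1] f) :
  measurable_fun [set: T2] g -> cancel f g ->
  sigma_finite [set: T1] mu -> sigma_finite [set: T2] (image_measure mu mf).
Proof.
move=> mg fK [F FT Foo].
exists (fun k => g @^-1` F k); first by rewrite -preimage_bigcup -FT.
move=> k; have [mF Fk] := Foo k; split.
  by rewrite -[X in measurable X]setTI; exact: mg.
rewrite /image_measure /pushforward -comp_preimage.
by rewrite (_ : g \o f = id)//; apply/funext => x /=; rewrite fK.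
Qed.

End image_measure.

Lemma product_measure1_sigma_finite d1 d2 (T1 : measurableType d1)
    (T2 : measurableType d2) (R : realType)
    (m1 : {sigma_finite_measure set T1 -> \bar R})
    (m2 : {sigma_finite_measure set T2 -> \bar R}) :
  sigma_finite [set: T1 * T2] (m1 \x m2)%E.
Proof.
have /sigma_finiteP[F [TF ndF Foo]] := sigma_finiteT m1.
have /sigma_finiteP[G [TG ndG Goo]] := sigma_finiteT m2.
exists (fun n => F n `*` G n).
  rewrite -setXTT TF TG predeqE => -[x y]; split.
    move=> [/= [n _ Fnx] [k _ Gky]]; exists (maxn n k) => //; split.
    - by move: x Fnx; exact/subsetPset/ndF/leq_maxl.
    - by move: y Gky; exact/subsetPset/ndG/leq_maxr.
  by move=> [n _ []/= ? ?]; split; exists n.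
move=> k; have [? ?] := Foo k; have [? ?] := Goo k.
split; first exact: measurableX.
by rewrite product_measure1E// lte_mul_pinfty// ge0_fin_numE.
Qed.

Section lebesgue_tuple.
Variable R : realType.
Local Open Scope ereal_scope.

Notation mR := (measurableTypeR R).

Definition tuple_cons n (p : mR * n.-tuple mR) : n.+1.-tuple mR :=
  [tuple of p.1 :: p.2].

Definition tuple_uncons n (t : n.+1.-tuple mR) : mR * n.-tuple mR :=
  (thead t, [tuple of behead t]).

Lemma measurable_tuple_cons n : measurable_fun setT (@tuple_cons n).
Proof. exact: measurable_cons. Qed.

Lemma measurable_tuple_uncons n : measurable_fun setT (@tuple_uncons n).
Proof.
apply: measurable_fun_pair; first exact: measurable_tnth.
exact: measurable_behead.
Qed.

Lemma tuple_consK n : cancel (@tuple_cons n) (@tuple_uncons n).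
Proof. by case=> x t; rewrite /tuple_uncons theadE; congr pair; exact: val_inj. Qed.

Section cons_measure.
Variables (n : nat) (mu : {sigma_finite_measure set (n.-tuple mR) -> \bar R}).

Definition lebesgue_cons : set (n.+1.-tuple mR) -> \bar R :=
  image_measure (@lebesgue_measure R \x mu) (@measurable_tuple_cons n).

HB.instance Definition _ := Measure.on lebesgue_cons.

Let lebesgue_cons_sigma_finite : sigma_finite setT lebesgue_cons.
Proof.
apply: image_measure_sigma_finite (@measurable_tuple_uncons n) (@tuple_consK n) _.
exact: product_measure1_sigma_finite.
Qed.

HB.instance Definition _ := Measure_isSigmaFinite.Build _ _ _ lebesgue_cons
  lebesgue_cons_sigma_finite.

End cons_measure.

(* The n-fold product of the Lebesgue measure of [R]. *)
Fixpoint lebesgue_tuple n : {sigma_finite_measure set (n.-tuple mR) -> \bar R} :=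
  if n is n'.+1 then lebesgue_cons (lebesgue_tuple n')
  else \d_([tuple] : 0.-tuple mR).

End lebesgue_tuple.

Section lebesgue_rV.
Variables (R : realType) (d : nat).
Local Open Scope ereal_scope.

Notation mR := (measurableTypeR R).

Definition row_of_tuple (t : d.-tuple mR) : 'rV[R]_d := \row_i tnth t i.

Definition tuple_of_row (x : 'rV[R]_d) : d.-tuple mR := [tuple x ord0 i | i < d].

Lemma row_of_tupleK : cancel row_of_tuple tuple_of_row.
Proof. by move=> t; apply: eq_from_tnth => i; rewrite tnth_mktuple mxE. Qed.

Lemma measurable_tuple_of_row : measurable_fun setT tuple_of_row.
Proof.
apply/measurable_fun_tnthP => i; apply: (measurability _ (RGenOpens.measurableE R)).
move=> _ [_ [a [b ->]] <-]; rewrite setTI; apply: sub_sigma_algebra => /=.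
rewrite (_ : _ @^-1` _ = (fun x : 'rV[R]_d => x ord0 i) @^-1` `]a, b[%classic).
  by apply: open_comp; [move=> x _; exact: coord_continuous
                       |exact: interval_open].
by apply/seteqP; split => x /=; rewrite tnth_mktuple.
Qed.

Lemma open_bigcup_rat_ball (U : set 'rV[R]_d) : open U ->
  U = \bigcup_(p in [set: 'rV[rat]_d * nat])
    [set x | ball (map_mx ratr p.1 : 'rV[R]_d) p.2.+1%:R^-1%R `<=` U /\
             ball (map_mx ratr p.1 : 'rV[R]_d) p.2.+1%:R^-1%R x].
Proof.
move=> oU; apply/seteqP; split => [x Ux|x [p _ [+ px]]]; last exact.
have /nbhs_ballP[e /= e0 eU] : nbhs x U by exact: open_nbhs_nbhs.
have [k ke] : exists k : nat, (k.+1%:R^-1 < e / 2 :> R)%R.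
  exists (Num.truncn (e / 2)^-1).
  by rewrite invf_plt ?posrE ?divr_gt0// truncnS_gt.
have k0 : (0 < k.+1%:R^-1 :> R)%R by [].
have /choice[q_ q_x] i : exists q : rat, (`|x ord0 i - ratr q| < k.+1%:R^-1)%R.
  have [|q] := @rat_in_itvoo _ (x ord0 i - k.+1%:R^-1)%R (x ord0 i).
    by rewrite gtrBl.
  rewrite in_itv/= => /andP[q1 q2]; exists q.
  by rewrite ger0_norm ?subr_ge0 1?ltW// ltrBlDl -ltrBlDr.
have qx : ball (map_mx ratr (\row_i q_ i) : 'rV[R]_d) k.+1%:R^-1%R x.
  split=> // i j; rewrite ord1 /ball/= !mxE distrC; exact: q_x.
exists (\row_i q_ i, k) => //; split => //= y qy; apply: eU.
rewrite (splitr e); apply: ball_triangle (le_ball (ltW ke) qy).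
by apply: ball_sym; exact: le_ball (ltW ke) _ qx.
Qed.

Lemma measurable_row_of_tuple : measurable_fun setT row_of_tuple.
Proof.
apply: (measurability (@open 'rV[R]_d)) => // _ [U oU <-]; rewrite setTI.
rewrite (open_bigcup_rat_ball oU) preimage_bigcup.
apply: countable_bigcupT_measurable => [|[q k] /=]; first exact: countableP.
have [qU|qU] := pselect (ball (map_mx ratr q : 'rV[R]_d) k.+1%:R^-1%R `<=` U);
  last by rewrite (_ : _ @^-1` _ = set0) // -subset0 => t [].
rewrite (_ : _ @^-1` _ = \bigcap_(i in [set: 'I_d])
    ((fun t : d.-tuple mR => tnth t i) @^-1` ball (ratr (q ord0 i) : R) k.+1%:R^-1%R)).
  rewrite bigcap_mkcond -[X in measurable X]setCK setC_bigcap.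
  apply: measurableC; apply: countable_bigcupT_measurable => // i.
  rewrite in_setT; apply: measurableC; rewrite -[X in measurable X]setTI.
  by apply: measurable_tnth => //; exact: measurable_ball.
apply/seteqP; split => [t [_ [_ tq]] i _ |t tq] /=.
  by have := tq ord0 i; rewrite !mxE.
split=> //; split=> // i j; rewrite ord1 !mxE; exact: tq.
Qed.

(* Lebesgue measure on R^d; see [lebesgue_rV_box] below for its value on
   products of measurable sets. *)
Definition lebesgue_rV : set 'rV[R]_d -> \bar R :=
  image_measure (lebesgue_tuple R d) measurable_row_of_tuple.

HB.instance Definition _ := Measure.on lebesgue_rV.

Let lebesgue_rV_sigma_finite : sigma_finite setT lebesgue_rV.
Proof.
apply: image_measure_sigma_finite measurable_tuple_of_row row_of_tupleK _.
exact: sigma_finiteT.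
Qed.

HB.instance Definition _ := Measure_isSigmaFinite.Build _ _ _ lebesgue_rV
  lebesgue_rV_sigma_finite.

End lebesgue_rV.

Section lebesgue_box.
Variable R : realType.
Local Open Scope ereal_scope.

Lemma measurable_tuple_box n (A : 'I_n -> set (measurableTypeR R)) :
  (forall i, measurable (A i)) ->
  measurable [set t : n.-tuple (measurableTypeR R) | forall i, A i (tnth t i)].
Proof.
move=> mA.
rewrite (_ : [set t | _] = \bigcap_(i in [set: 'I_n])
    ((fun t : n.-tuple (measurableTypeR R) => tnth t i) @^-1` A i)); last first.
  by apply/seteqP; split => [t At i _|t At i]; exact: At.
rewrite bigcap_mkcond -[X in measurable X]setCK setC_bigcap.
apply: measurableC; apply: countable_bigcupT_measurable => // i.
rewrite in_setT; apply: measurableC; rewrite -[X in measurable X]setTI.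
exact: measurable_tnth.
Qed.

Lemma lebesgue_tuple_box n (A : 'I_n -> set (measurableTypeR R)) :
  (forall i, measurable (A i)) ->
  lebesgue_tuple R n [set t | forall i, A i (tnth t i)] =
  \prod_(i < n) lebesgue_measure (A i).
Proof.
elim: n A => [A mA|n IHn A mA].
  by rewrite big_ord0 /= diracE mem_set// => -[].
rewrite big_ord_recl -(IHn (fun i => A (lift ord0 i)))//.
have mB := measurable_tuple_box (fun i => mA (lift ord0 i)).
rewrite -(product_measure1E _ _ (mA ord0) mB).
rewrite /= /lebesgue_cons /image_measure /pushforward; congr (_ _).
apply/seteqP; split => [[x t] /= At|[x t] /= [Ax At] i].
  by split=> [|i]; [have := At ord0; rewrite tnth0|have := At (lift ord0 i); rewrite tnthS].
by case: (unliftP ord0 i) => [j|] ->; rewrite ?tnthS ?tnth0.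
Qed.

Lemma lebesgue_rV_box d (A : 'I_d -> set R) :
  (forall i, measurable (A i : set (measurableTypeR R))) ->
  lebesgue_rV [set x : 'rV[R]_d | forall i, A i (x ord0 i)] =
  \prod_(i < d) lebesgue_measure (A i).
Proof.
move=> mA; rewrite -lebesgue_tuple_box//.
rewrite /lebesgue_rV /image_measure /pushforward; congr (_ _).
by apply/seteqP; split => t /= At i; have := At i; rewrite mxE.
Qed.

End lebesgue_box.

Section quantization.
Variables (R : realType) (d : nat).
Implicit Types (N f : 'rV[R]_d -> R) (P : probability 'rV[R]_d R).
Implicit Types (A : set 'rV[R]_d) (x : 'rV[R]_d).

Definition is_norm N : Prop :=
  [/\ forall x y, N (x + y) <= N x + N y,
      forall (a : R) x, N (a *: x) = `|a| * N x &
      forall x, N x = 0 -> x = 0].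

Definition cball N x (rho : R) : set 'rV[R]_d := [set y | N (y - x) <= rho].

Definition dist N x A : R := inf [set N (x - a) | a in A].

(* [open] refers to the canonical topology of ['rV[R]_d], which is the one
   induced by any norm [N]. *)
Definition supp P : set 'rV[R]_d :=
  [set x | forall U : set 'rV[R]_d, open U -> U x -> (0 < P U)%E].

Definition is_density P f : Prop :=
  [/\ measurable_fun [set: 'rV[R]_d] f,
      forall x, 0 <= f x &
      forall A, measurable A ->
        P A = (\int[@lebesgue_rV R d]_(x in A) (f x)%:E)%E].

Definition distortion N P (r : R) A : \bar R :=
  (\int[P]_x (dist N x A `^ r)%:E)%E.

Definition optimal_quantizer N P (r : R) (n : nat) A : Prop :=
  [/\ A !=set0, (A #<= `I_n)%card &
      forall B : set 'rV[R]_d, B !=set0 -> (B #<= `I_n)%card ->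
        (distortion N P r A <= distortion N P r B)%E].

Definition kappa N P : \bar R :=
  ereal_inf [set (lebesgue_rV (supp P `&` cball N x rho)
                  / lebesgue_rV (cball N x rho))%E
            | x in supp P & rho in [set rho : R | 0 < rho]].

Definition growth_condition N P f (eps : R) : Prop :=
  exists eta M C : R,
    [/\ 0 < eta < 1 / 2, 0 < M, 0 < C &
        forall x y, supp P x -> supp P y ->
          M <= N x -> N (y - x) <= 2 * eta * N x ->
          C * (f x `^ (1 + eps)) <= f y].

(* The inverse is the one of [\bar R], so that 1 / 0 = +oo. *)
Definition neg_moment P f (q : R) : \bar R :=
  (\int[P]_x ((f x `^ q)%:E)^-1)%E.

Definition rate_bound N P (alpha : nat -> set 'rV[R]_d) (s : R) : Prop :=
  (ereal_sup [set (n%:R `^ (s / d%:R))%:E * distortion N P s (alpha n)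
             | n in [set n : nat | (1 <= n)%N]] < +oo)%E.

End quantization.

(* Main.v *)
Require Import Defs.
From HB Require Import structures.
From mathcomp Require Import all_boot all_order all_algebra.
From mathcomp Require Import all_classical all_reals all_analysis.
From mathcomp Require Import measurable_realfun.
From mathcomp Require Import ring lra.
Set Implicit Arguments.
Unset Strict Implicit.
Unset Printing Implicit Defensive.
Import Order.TTheory GRing.Theory Num.Theory.
Import numFieldNormedType.Exports.
Local Open Scope classical_set_scope.
Local Open Scope ring_scope.

(** Let [u_n x] be the distance from [x] to the quantizer [alpha n].

    The heart of the proof is the micro-macro inequality [micro_macro]: for a
    fixed ratio [b < 1 / 2] and uniformly in [n] and [x],
      [u_n x `^ r * P (B (x, b * u_n x)) <= C * n `^ (- (d + r) / d)].
    Adding [x] to [alpha n] lowers the distortion by at least a constant times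
    the left-hand side, since the points of the ball are closer to [x] than to
    [alpha n] by a fixed factor. When [alpha n] has exactly [n >= 2] points, the
    cardinality is restored by removing one of them, [a]. Optimality says that
    the gain is at most the loss, and the loss is confined to the strict Voronoi
    cell of [a], where a neighbour of [a] takes its place. By pigeonhole at least
    half of the [n] points have a neighbour at a distance of order
    [n `^ (- 1 / d)], up to a weight [(1 + N a) `^ (1 + theta)] which the
    moment of order [r + delta] absorbs when [theta = delta / r]. The cells are
    disjoint and the total error is of order [n `^ (- r / d)], hence some [a] has
    a loss of order
    [n `^ (-1) * n `^ (- r / d)]; this is [removable_point]. The pigeonholes are
    the cells of a grid whose mesh grows at infinity like the weight, given by
    [weighted_cover]. The same lemma, applied to the whole space, gives the bound
    on the total error.

    The micro-macro inequality is then used in two ways.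

    On a bounded set it is integrated in [x] against Lebesgue measure. Exchanging
    the integrals ([averaging]) and using that [u_n] is Lipschitz, one finds that
    the integral of [u_n `^ (d + r)] against [P] over the bounded set is of order
    [n `^ (- (d + r) / d)]; since [s < d + r] this settles the order [s] there.

    Far from the origin the ball [B (x, eta * u_n x)] lies in the region where
    the growth condition compares the density with its value at [x], because
    [u_n x <= 2 * N x]. With [kappa > 0] its mass is at least a constant times
    [f x `^ (1 + eps) * u_n x `^ d] ([growth_mass]). The micro-macro inequality
    becomes a pointwise bound on [n `^ (1 / d) * u_n x] ([tail_bound]): its
    [s]-th power is at most a constant times the integrand of the negative moment
    of [f], which is assumed to be finite.

    The last claim of the theorem follows with [eps] so small that
    [s * (1 + eps) < d + r]; the formula for the negative moment is the change of
    measure from [P] to Lebesgue measure. *)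

(** * Norms on the space of row vectors *)

Lemma coord_le_mx_norm (R : realType) d (x : 'rV[R]_d) i : `|x ord0 i| <= `|x|.
Proof.
rewrite [leRHS]/Num.norm/= mx_normrE.
exact: (le_bigmax _ (fun ij : (_ * _)%type => `|x ij.1 ij.2|) (ord0, i)).
Qed.

Section norm.
Context (R : realType) (d : nat) (N : 'rV[R]_d -> R) (hN : is_norm N).

Lemma nrm_triangle x y : N (x + y) <= N x + N y.
Proof. by have [] := hN. Qed.

Lemma nrmZ (a : R) x : N (a *: x) = `|a| * N x.
Proof. by have [] := hN. Qed.

Lemma nrm0 : N 0 = 0.
Proof. by rewrite -[0 in LHS](scale0r 0) nrmZ normr0 mul0r. Qed.

Lemma nrmN x : N (- x) = N x.
Proof. by rewrite -scaleN1r nrmZ normrN1 mul1r. Qed.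

Lemma nrm_ge0 x : 0 <= N x.
Proof.
have := nrm_triangle x (- x); rewrite subrr nrm0 nrmN.
by rewrite -mulr2n pmulrn_lge0.
Qed.

Lemma nrm_eq0 x : N x = 0 -> x = 0.
Proof. by have [_ _] := hN; exact. Qed.

Lemma nrm_subC x y : N (x - y) = N (y - x).
Proof. by rewrite -nrmN opprB. Qed.

Lemma nrm_sub_triangle x y z : N (x - z) <= N (x - y) + N (y - z).
Proof. by rewrite -[x - z](subrKA y) nrm_triangle. Qed.

Lemma nrm_le_mx_norm : exists2 C : R, 0 < C & forall x, N x <= C * `|x|.
Proof.
exists (1 + \sum_(i < d) N (delta_mx 0 i)).
  by rewrite ltr_pwDl// sumr_ge0// => i _; exact: nrm_ge0.
move=> x; rewrite mulrDl mul1r.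
apply: (@le_trans _ _ (\sum_(i < d) N (delta_mx 0 i) * `|x|)); last first.
  by rewrite -mulr_suml lerDr.
rewrite {1}[x]row_sum_delta.
apply: (big_ind2 (fun u v => N u <= v)).
- by rewrite nrm0.
- by move=> u u' v v' uu' vv'; apply: (le_trans (nrm_triangle _ _)); exact: lerD.
- move=> i _; rewrite nrmZ mulrC ler_wpM2l ?nrm_ge0//.
  exact: coord_le_mx_norm.
Qed.

Lemma nrm_sub_le x y : N x - N y <= N (x - y).
Proof. by rewrite lerBlDr; have := nrm_triangle (x - y) y; rewrite subrK. Qed.

(** A function which is Lipschitz for [N] is continuous for the canonical
    topology because that topology is the one of the maximum norm, which
    dominates [N]. *)
Lemma lipschitz_nrm_continuous (u : 'rV[R]_d -> R) :
  (forall x y, u x - u y <= N (x - y)) -> continuous u.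
Proof.
move=> ulip x; have [C C0 NC] := nrm_le_mx_norm.
apply: (cvgrPdist_lt (F := nbhs x) u (u x)).2 => e e0; apply/nbhs_ballP; exists (e / C).
  exact: divr_gt0.
move=> y; rewrite mx_norm_ball => /= xy.
have {}xy : N (x - y) < e.
  by apply: (le_lt_trans (NC _)); rewrite mulrC -ltr_pdivlMr.
rewrite ltr_norml ltrNl opprB.
rewrite (le_lt_trans (ulip y x)) ?(le_lt_trans (ulip x y))//.
by rewrite nrm_subC.
Qed.

Lemma nrm_continuous : continuous N.
Proof. exact/lipschitz_nrm_continuous/nrm_sub_le. Qed.

(** By compactness of the unit sphere of the maximum norm, on which [N] attains
    a minimum; that minimum is positive by definiteness. *)
Lemma mx_norm_le_nrm : exists2 C : R, 0 < C & forall x, `|x| <= C * N x.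
Proof.
pose S : set 'rV[R]_d := [set x | `|x| = 1].
have [S0|/set0P S0] := eqVneq S set0.
  exists 1 => // x; have [->|x0] := eqVneq x 0; first by rewrite nrm0 normr0 mulr0.
  have : S (`|x|^-1 *: x).
    by rewrite /S/= normrZ normfV normr_id mulVf// normr_eq0.
  by rewrite S0.
have cS : compact S.
  apply: bounded_closed_compact.
    by exists 1; split=> // M M1 x /= ->; exact: ltW.
  rewrite (_ : S = (fun x : 'rV[R]_d => `|x|) @^-1` [set 1]); last by [].
  apply: closed_comp; last exact: closed_eq.
  by move=> x _; exact: norm_continuous.
have [c /set_mem cS1 cmin] := EVT_min_rV S0 cS (continuous_subspaceT nrm_continuous).
have Nc0 : 0 < N c.
  rewrite lt_neqAle nrm_ge0 andbT eq_sym; apply/eqP => /nrm_eq0 c0.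
  by move: cS1; rewrite c0 /S/= normr0 => /eqP; rewrite eq_sym oner_eq0.
exists (N c)^-1; first by rewrite invr_gt0.
move=> x; have [->|x0] := eqVneq x 0; first by rewrite nrm0 normr0 mulr0.
have nx0 : 0 < `|x| by rewrite normr_gt0.
have /mem_set/cmin : S (`|x|^-1 *: x).
  by rewrite /S/= normrZ normfV normr_id mulVf// normr_eq0.
by rewrite nrmZ normfV normr_id !ler_pdivlMl// mulrC.
Qed.

End norm.

Lemma continuous_measurable_rV (R : realType) d (u : 'rV[R]_d -> R) :
  continuous u -> measurable_fun [set: 'rV[R]_d] u.
Proof.
move=> cu; apply: (measurability _ (RGenOpens.measurableE R)).
move=> _ [_ [a [b ->]] <-]; rewrite setTI; apply: sub_sigma_algebra => /=.
by apply: open_comp; [move=> x _; exact: cu|exact: interval_open].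
Qed.

(** * Distance to a set *)

Section dist.
Context (R : realType) (d : nat) (N : 'rV[R]_d -> R) (hN : is_norm N).
Implicit Types (x y : 'rV[R]_d) (A B : set 'rV[R]_d).

Lemma has_lbound_dist x A : has_lbound [set N (x - a) | a in A].
Proof. by exists 0 => _ [a _ <-]; exact: nrm_ge0. Qed.

Lemma dist_ge0 x A : 0 <= dist N x A.
Proof.
have [->|/set0P A0] := eqVneq A set0; first by rewrite /dist image_set0 inf0.
apply: lb_le_inf; last by move=> _ [a _ <-]; exact: nrm_ge0.
by case: A0 => a Aa; exists (N (x - a)), a.
Qed.

Lemma dist_le x a A : A a -> dist N x A <= N (x - a).
Proof. by move=> Aa; apply: (ge_inf (has_lbound_dist x A)); exists a. Qed.

Lemma dist_adherent x A (e : R) : A !=set0 -> 0 < e ->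
  exists2 a, A a & N (x - a) < dist N x A + e.
Proof.
move=> [a0 Aa0] e0; have [|_ [a Aa <-] h] := inf_adherent e0 (E := [set N (x - a) | a in A]).
  by split; [exists (N (x - a0)), a0|exact: has_lbound_dist].
by exists a.
Qed.

Lemma dist_sub_le x y A : A !=set0 -> dist N x A - dist N y A <= N (x - y).
Proof.
move=> A0; apply/ler_addgt0Pr => e e0; have [a Aa ya] := dist_adherent y A0 e0.
have := dist_le x Aa; have := nrm_sub_triangle hN x y a; lra.
Qed.

Lemma dist_le_nrm x A : A !=set0 -> dist N x A <= N x + dist N 0 A.
Proof. by move=> A0; have := dist_sub_le x 0 A0; rewrite subr0; lra. Qed.

Lemma dist_subset x A B : A !=set0 -> A `<=` B -> dist N x B <= dist N x A.
Proof.
move=> A0 AB; apply/ler_addgt0Pr => e e0; have [a Aa ya] := dist_adherent x A0 e0.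
by have := dist_le x (AB _ Aa); lra.
Qed.

Lemma dist_attained x A : A !=set0 -> finite_set A ->
  exists2 a, A a & N (x - a) = dist N x A.
Proof.
move=> A0 /finite_compact cA.
have cx : continuous (fun a : 'rV[R]_d => N (x - a)).
  apply: (lipschitz_nrm_continuous hN) => y z.
  by rewrite (le_trans (nrm_sub_le hN _ _))// opprB addrC subrKA (nrm_subC hN).
have [a /set_mem Aa amin] := EVT_min_rV A0 cA (continuous_subspaceT cx).
exists a => //; apply/eqP; rewrite eq_le dist_le// andbT.
apply: lb_le_inf; first by exists (N (x - a)), a.
by move=> _ [b /mem_set Ab <-]; exact: amin.
Qed.

Lemma dist_continuous A : A !=set0 -> continuous (fun x => dist N x A).
Proof.
by move=> A0; apply: (lipschitz_nrm_continuous hN) => x y; exact: dist_sub_le.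
Qed.

Lemma measurable_dist A : A !=set0 -> measurable_fun setT (fun x => dist N x A).
Proof. by move=> A0; apply: continuous_measurable_rV; exact: dist_continuous. Qed.

Lemma measurable_dist_powR A (s : R) : A !=set0 ->
  measurable_fun setT (fun x => (dist N x A `^ s)%:E).
Proof.
move=> A0; apply/measurable_EFinP.
by apply: (measurableT_comp (measurable_powR s)); exact: measurable_dist.
Qed.

Lemma measurable_nrm : measurable_fun setT N.
Proof. apply: continuous_measurable_rV; exact: nrm_continuous. Qed.

Lemma measurable_nrm_powR (s : R) : measurable_fun setT (fun x => (N x `^ s)%:E).
Proof.
apply/measurable_EFinP.
by apply: (measurableT_comp (measurable_powR s)); exact: measurable_nrm.
Qed.

Lemma measurable_cball x (rho : R) : measurable (cball N x rho).
Proof.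
rewrite -[cball _ _ _]setTI.
apply: (measurable_fun_le (D := setT) (f := fun y => N (y - x)) (g := cst rho)) => //.
apply: continuous_measurable_rV; apply: (lipschitz_nrm_continuous hN) => y z.
by rewrite (le_trans (nrm_sub_le hN _ _))// opprB addrA subrK.
Qed.

End dist.

(** * Covering with a mesh that grows at infinity *)

(** After division by [v] this is [1 - u / v <= ln (v / u)] followed by
    [theta * ln (v / u) <= (v / u) `^ theta - 1]: the graphs of [ln] and [exp]
    compared with their tangents. *)
Lemma powR_gap (R : realType) (theta u v : R) : 0 < theta -> 0 < u -> u <= v ->
  v - u <= theta^-1 * v `^ (1 + theta) * (u `^ (- theta) - v `^ (- theta)).
Proof.
move=> t0 u0 uv; have v0 := lt_le_trans u0 uv.
have -> : theta^-1 * v `^ (1 + theta) * (u `^ (- theta) - v `^ (- theta)) =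
    v * (theta^-1 * ((v / u) `^ theta - 1)).
  have -> : v `^ (1 + theta) = v * v `^ theta.
    by rewrite powRD ?(gt_eqF v0) ?implybT// powRr1// ltW.
  rewrite powRM ?invr_ge0 ?ltW//.
  have -> : u^-1 `^ theta = u `^ (- theta).
    by rewrite -(powR_inv1 (ltW u0)) -powRrM mulN1r.
  rewrite [v `^ (- theta)]powRN.
  have := powR_gt0 theta v0; move: (v `^ theta) (u `^ _) => a b a0.
  by field; rewrite !gt_eqF.
have -> : v - u = v * (1 - u / v) by field; rewrite gt_eqF.
rewrite ler_pM2l// ler_pdivlMl//.
have w0 : 0 < v / u by exact: divr_gt0.
have lnw : 1 - u / v <= ln (v / u).
  rewrite -[v / u]invrK lnV ?posrE ?invr_gt0// invf_div.
  rewrite lerNr opprB; have := @le_ln1Dx _ (u / v - 1).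
  rewrite [1 + _]addrC subrK; apply.
  by rewrite ltrBDr addNr divr_gt0.
rewrite lerBrDl /powR gt_eqF//; apply: le_trans (expR_ge1Dx _).
by rewrite lerD2l ler_pM2l.
Qed.

Section compress.
Context (R : realType) (theta : R) (theta0 : 0 < theta).

(** An odd increasing homeomorphism of the line onto the open interval between
    -1 and 1, whose inverse has a derivative of order [1 + |y|] to the power
    [1 + theta] at the image of [y]: a uniform grid of the interval becomes a
    grid of the line with that mesh. *)
Definition compress (y : R) : R := Num.sg y * (1 - (1 + `|y|) `^ (- theta)).

Lemma compressN y : compress (- y) = - compress y.
Proof. by rewrite /compress sgrN normrN mulNr. Qed.

Lemma compress_lt1 y : `|compress y| < 1.
Proof.
have y1 : 1 <= 1 + `|y| by rewrite lerDl.
have p1 : (1 + `|y|) `^ (- theta) <= 1.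
  rewrite powRN invf_le1 ?powR_gt0 ?(lt_le_trans ltr01)//.
  by have := ler_powR y1 (ltW theta0); rewrite powRr0.
have p0 : 0 < (1 + `|y|) `^ (- theta) by rewrite powR_gt0// (lt_le_trans ltr01).
rewrite /compress normrM [X in _ * X]ger0_norm ?subr_ge0//.
apply: (@le_lt_trans _ _ (1 - (1 + `|y|) `^ (- theta))); last by rewrite gtrBl.
by rewrite ler_piMl ?subr_ge0// normr_sg lern1 leq_b1.
Qed.

Lemma compress_ge0 y : 0 <= y -> compress y = 1 - (1 + y) `^ (- theta).
Proof.
rewrite le_eqVlt => /predU1P[<-|y0].
  by rewrite /compress sgr0 mul0r addr0 powR1 subrr.
by rewrite /compress gtr0_sg// mul1r gtr0_norm.
Qed.

(** The mean value inequality for the inverse of [compress], in an integrated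
    form: [powR_gap] on a half-line, and the sum of two instances which start at
    the origin when the signs differ. *)
Lemma compress_gap (y z : R) : `|y - z| <=
  theta^-1 * (1 + (`|y| + `|z|)) `^ (1 + theta) * `|compress y - compress z|.
Proof.
have mono (u v w : R) : 1 <= u -> u <= v -> v <= w ->
    v - u <= theta^-1 * w `^ (1 + theta) * (u `^ (- theta) - v `^ (- theta)).
  move=> u1 uv vw; apply: (le_trans (powR_gap theta0 (lt_le_trans ltr01 u1) uv)).
  have v0 : 0 < v by apply: lt_le_trans uv; apply: lt_le_trans u1.
  apply: ler_wpM2r.
    rewrite subr_ge0 !powRN lef_pV2 ?posrE ?powR_gt0 ?(lt_le_trans ltr01)//.
    by rewrite ge0_ler_powR ?nnegrE ?(ltW theta0)// ?(ltW v0)// (le_trans ler01).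
    exact: le_trans uv.
  rewrite ler_wpM2l ?invr_ge0 ?(ltW theta0)// ge0_ler_powR ?nnegrE ?(ltW v0)//.
    by rewrite addr_ge0// ltW.
  by rewrite (le_trans (ltW v0)).
have pos (a b : R) : 0 <= a -> a <= b -> forall w : R, 1 + b <= w ->
    `|b - a| <= theta^-1 * w `^ (1 + theta) * `|compress b - compress a|.
  move=> a0 ab w bw; rewrite ger0_norm ?subr_ge0//.
  rewrite !compress_ge0// ?(le_trans a0)//.
  have -> : b - a = (1 + b) - (1 + a) by lra.
  apply: (le_trans (mono _ _ w _ _ _)) => //; [by rewrite lerDl|by rewrite lerD2l|].
  rewrite ler_wpM2l ?mulr_ge0 ?invr_ge0 ?(ltW theta0) ?powR_ge0//.
  by rewrite (le_trans _ (ler_norm _))//; lra.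
have pos2 (a b : R) : 0 <= a -> 0 <= b -> forall w : R, 1 + (a + b) <= w ->
    `|a - b| <= theta^-1 * w `^ (1 + theta) * `|compress a - compress b|.
  move=> a0 b0 w abw; have [ab|/ltW ba] := leP a b.
    by rewrite distrC [X in _ * X]distrC; apply: pos => //; lra.
  by apply: pos => //; lra.
have opp (a b : R) : 0 <= a -> 0 <= b -> forall w : R, 1 + (a + b) <= w ->
    `|a + b| <= theta^-1 * w `^ (1 + theta) * `|compress a + compress b|.
  move=> a0 b0 w abw; rewrite !compress_ge0//.
  rewrite ger0_norm ?addr_ge0//.
  have ha : a <= theta^-1 * w `^ (1 + theta) * (1 - (1 + a) `^ (- theta)).
    by have := @mono 1 (1 + a) w; rewrite powR1 => H; rewrite {1}(_ : a = 1 + a - 1); last lra;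
      apply: H => //; lra.
  have hb : b <= theta^-1 * w `^ (1 + theta) * (1 - (1 + b) `^ (- theta)).
    by have := @mono 1 (1 + b) w; rewrite powR1 => H; rewrite {1}(_ : b = 1 + b - 1); last lra;
      apply: H => //; lra.
  apply: (le_trans (lerD ha hb)); rewrite -mulrDr.
  by rewrite ler_wpM2l ?mulr_ge0 ?invr_ge0 ?(ltW theta0) ?powR_ge0// ler_norm.
have [y0|/ltW y0] := leP 0 y; have [z0|/ltW z0] := leP 0 z.
- by apply: pos2 => //; rewrite !ger0_norm.
- have := @opp y (- z) y0; rewrite oppr_ge0 => /(_ z0) H.
  rewrite (_ : compress z = - compress (- z)) ?compressN ?opprK// -compressN.
  by apply: H; rewrite ger0_norm// ler0_norm.
- have := @opp (- y) z; rewrite oppr_ge0 => /(_ y0 z0) H.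
  rewrite -normrN opprB addrC -[X in _ <= _ * X]normrN opprB.
  rewrite [compress z - _]addrC -compressN.
  by apply: H; rewrite ler0_norm// ger0_norm.
- have := @pos2 (- y) (- z); rewrite !oppr_ge0 => /(_ y0 z0) H.
  rewrite -normrN opprD -[X in _ <= _ * X]normrN opprD.
  move: H; rewrite !compressN => H.
  by apply: H; rewrite !ler0_norm.
Qed.

End compress.

Lemma mx_norm_le (R : realType) d (x : 'rV[R]_d) (c : R) : 0 <= c ->
  (forall i, `|x ord0 i| <= c) -> `|x| <= c.
Proof.
move=> c0 xc; rewrite [leLHS]/Num.norm/= mx_normrE.
by apply: bigmax_le => // -[i j] _ /=; rewrite ord1.
Qed.

Section weighted_cover.
Context (R : realType) (theta : R) (theta0 : 0 < theta).

(** The interval of a regular subdivision of ]-1, 1[ which contains the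
    compressed point; the bound [compress_lt1] keeps [inord] away from its default
    value. *)
Definition cell (k : nat) (y : R) : 'I_k.+1 :=
  inord (Num.truncn (k.+1%:R * ((compress theta y + 1) / 2))).

Lemma cell_gap k (y z : R) : cell k y = cell k z ->
  `|compress theta y - compress theta z| <= 2 / k.+1%:R.
Proof.
have main (x : R) : (nat_of_ord (cell k x))%:R <=
    k.+1%:R * ((compress theta x + 1) / 2) < (cell k x).+1%:R.
  have := compress_lt1 theta0 x; rewrite ltr_norml => /andP[x0 x1].
  have h0 : 0 <= k.+1%:R * ((compress theta x + 1) / 2).
    by rewrite mulr_ge0// divr_ge0//; lra.
  rewrite /cell inordK ?truncn_itv// truncn_lt_nat//.
  by rewrite gtr_pMr// ltr_pdivrMr//; lra.
move=> yz; have := main y; have := main z; rewrite yz.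
rewrite -[(cell k z).+1%:R]natr1; move: (_%:R) (k.+1%:R) (ltr0Sn R k) => c K K0.
move=> /andP[z1 z2] /andP[y1 y2].
by rewrite ler_norml -mulNr ler_pdivrMr// ler_pdivlMr//; apply/andP; split; lra.
Qed.

Context (d : nat) (N : 'rV[R]_d -> R) (hN : is_norm N) (d0 : (0 < d)%N).

(** Comparison of [N] with the maximum norm transfers the one-dimensional
    estimate [compress_gap]. *)
Lemma cell_diam : exists2 C : R, 0 < C & forall k (y z : 'rV[R]_d),
  (forall i, cell k (y ord0 i) = cell k (z ord0 i)) ->
  N (y - z) <= C / k.+1%:R * (1 + (N y + N z)) `^ (1 + theta).
Proof.
have [C C0 NC] := nrm_le_mx_norm hN.
have [D D0 ND] := mx_norm_le_nrm hN.
exists (C * (theta^-1 * (1 + D) `^ (1 + theta) * 2)).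
  by rewrite !mulr_gt0 ?invr_gt0// powR_gt0// addr_gt0.
move=> k y z yz; apply: (le_trans (NC _)).
have w0 : 0 <= 1 + (N y + N z) by rewrite !addr_ge0// ?nrm_ge0.
have -> : C * (theta^-1 * (1 + D) `^ (1 + theta) * 2) / k.+1%:R *
    (1 + (N y + N z)) `^ (1 + theta) =
    C * (theta^-1 * ((1 + D) * (1 + (N y + N z))) `^ (1 + theta) *
         (2 / k.+1%:R)).
  by rewrite powRM ?addr_ge0 ?(ltW D0) ?nrm_ge0//; ring.
rewrite ler_pM2l//; apply: mx_norm_le => [|i].
  by rewrite !mulr_ge0 ?invr_ge0 ?powR_ge0// ltW.
rewrite !mxE; apply: (le_trans (compress_gap theta0 _ _)).
apply: ler_pM => //.
- by rewrite mulr_ge0 ?powR_ge0 ?invr_ge0// ltW.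
- rewrite ler_pM2l ?invr_gt0//; apply: ge0_ler_powR; rewrite ?nnegrE.
  + by rewrite addr_ge0// ltW.
  + by rewrite addr_ge0// addr_ge0.
  + by rewrite mulr_ge0// addr_ge0// ltW.
  have yD := le_trans (coord_le_mx_norm y i) (ND y).
  have zD := le_trans (coord_le_mx_norm z i) (ND z).
  have := nrm_ge0 hN y; have := nrm_ge0 hN z; nra.
- exact: cell_gap.
Qed.

(** The largest [k] with [2 * k ^ d <= n] satisfies [n <= (4 * k) ^ d], because
    [k + 1 <= 2 * k] and [2 <= 2 ^ d]. *)
Lemma ex_mesh n : (2 <= n)%N ->
  exists2 k : nat, (2 * k.+1 ^ d <= n)%N &
    k.+1%:R^-1 <= 4 * n%:R `^ (- d%:R^-1) :> R.
Proof.
move=> n2.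
have [|k kn|k kn kmax] := @ex_maxnP (fun k => (2 * k ^ d <= n)%N) n.
- by exists 1%N; rewrite exp1n.
- case: k kn => // k kn.
  have : (k.+1 ^ 1 <= k.+1 ^ d)%N by rewrite leq_pexp2l.
  by rewrite expn1 => h; rewrite (leq_trans h)// (leq_trans _ kn)// leq_pmull.
have k0 : (0 < k)%N by apply: kmax; rewrite exp1n.
case: k kn kmax k0 => // k kn kmax _; exists k => //.
have nk : (n <= (4 * k.+1) ^ d)%N.
  have h : (n < 2 * k.+2 ^ d)%N by rewrite ltnNge; apply/negP => /kmax; rewrite ltnn.
  apply: (leq_trans (ltnW h)).
  have -> : (4 * k.+1 = 2 * (2 * k.+1))%N by rewrite mulnA.
  rewrite expnMn leq_mul//.
    by have : (2 ^ 1 <= 2 ^ d)%N by rewrite leq_exp2l.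
  by rewrite leq_exp2r// mulnC muln2 -addnn !addSn addnS !ltnS leq_addr.
have dR : d%:R != 0 :> R by rewrite pnatr_eq0 -lt0n.
have : n%:R `^ (d%:R^-1) <= ((4 * k.+1) ^ d)%:R `^ (d%:R^-1) :> R.
  by rewrite ge0_ler_powR ?nnegrE// ler_nat.
rewrite natrX -powR_mulrn// -powRrM mulfV// powRr1// natrM => h.
rewrite powRN ler_pdivlMr ?powR_gt0 ?ltr0n ?(leq_trans _ n2)//.
by rewrite ler_pdivrMl// mulrC.
Qed.

End weighted_cover.

Lemma ffun_image_card (R : realType) d k (g : {ffun 'I_d -> 'I_k} -> 'rV[R]_d)
    (G : set {ffun 'I_d -> 'I_k}) : (g @` G #<= `I_(k ^ d))%card.
Proof.
have [->|/set0P [c0 _]] := eqVneq G set0; first by rewrite image_set0; exact: card_ge0.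
have -> : (k ^ d)%N = size (enum {ffun 'I_d -> 'I_k}).
  by rewrite -cardE card_ffun !card_ord.
apply: card_le_trans (card_image_le (fun i => g (nth c0 (enum {ffun 'I_d -> 'I_k}) i)) _).
apply: subset_card_le => _ [c _ <-]; exists (index c (enum {ffun 'I_d -> 'I_k})).
  by rewrite /= index_mem mem_enum.
by rewrite nth_index// mem_enum.
Qed.

(** One representative is kept for each nonempty product of cells. Taking one
    whose norm is minimal up to 1 lets the mesh at [y] be controlled by the norm
    of [y] alone. With the whole space for [A] this builds good quantizers; with a
    quantizer for [A] it finds points that have another point of the quantizer
    nearby, and [2 * m <= n] then leaves at least half of [n] points outside
    [B]. *)
Lemma weighted_cover (R : realType) (theta : R) (theta0 : 0 < theta) (d : nat)
    (N : 'rV[R]_d -> R) (hN : is_norm N) (d0 : (0 < d)%N) :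
  exists2 C : R, 0 < C & forall n (A : set 'rV[R]_d), (2 <= n)%N -> A !=set0 ->
  exists2 B, [/\ B `<=` A, B !=set0 &
    exists2 m, (2 * m <= n)%N & (B #<= `I_m)%card] &
    forall y, A y -> exists2 z, B z &
      N (y - z) <= C * n%:R `^ (- d%:R^-1) * (1 + N y) `^ (1 + theta).
Proof.
have [C C0 HC] := cell_diam theta0 hN.
exists (C * 4 * 3 `^ (1 + theta)); first by rewrite !mulr_gt0 ?powR_gt0.
move=> n A n2 [a0 Aa0]; have [k kn kle] := ex_mesh R d0 n2.
pose cl (y : 'rV[R]_d) := [ffun i => cell theta k (y ord0 i)].
pose A_ g := A `&` [set y | cl y = g].
have /choice[rep repP] g : exists z, A_ g !=set0 ->
    A_ g z /\ forall y, A_ g y -> N z <= 1 + N y.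
  have [->|/set0P Ag] := eqVneq (A_ g) set0; first by exists 0 => -[].
  have [z Az] := dist_adherent hN 0 Ag ltr01.
  rewrite sub0r (nrmN hN) => zd; exists z => _; split=> // y Ay.
  have := dist_le hN 0 Ay; rewrite sub0r (nrmN hN); lra.
exists (rep @` [set g | A_ g !=set0]).
  split.
  - by move=> _ [g /repP[[Az _] _] <-].
  - by exists (rep (cl a0)), (cl a0) => //; exists a0.
  - by exists (k.+1 ^ d)%N => //; exact: ffun_image_card.
move=> y Ay; have Acy : A_ (cl y) y by [].
have Ac0 : A_ (cl y) !=set0 by exists y.
have [[_ cz] zmin] := repP _ Ac0.
exists (rep (cl y)); first by exists (cl y).
have := zmin _ Acy; move: cz; move: (rep _) => z /= cz zy.
apply: (le_trans (HC k _ _ _)).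
  by move=> i; move/ffunP : cz => /(_ i); rewrite !ffunE.
have y0 := nrm_ge0 hN y; have z0 := nrm_ge0 hN z.
have W : (1 + (N y + N z)) `^ (1 + theta) <= 3 `^ (1 + theta) * (1 + N y) `^ (1 + theta).
  rewrite -powRM ?addr_ge0//; apply: ge0_ler_powR; rewrite ?nnegrE.
  - by rewrite addr_ge0// ltW.
  - by rewrite !addr_ge0.
  - by rewrite mulr_ge0 ?addr_ge0.
  lra.
apply: (@le_trans _ _ (C * (4 * n%:R `^ (- d%:R^-1)) *
    (3 `^ (1 + theta) * (1 + N y) `^ (1 + theta)))); last first.
  by rewrite le_eqVlt; apply/orP; left; apply/eqP; ring.
by rewrite ler_pM ?powR_ge0 ?mulr_ge0 ?invr_ge0 ?ler_pM2l ?(ltW C0).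
Qed.

(** * Lebesgue measure of balls, supports and densities *)

Section volume.
Context (R : realType) (d : nat) (N : 'rV[R]_d -> R) (hN : is_norm N).

Let box (x : 'rV[R]_d) (h : R) : set 'rV[R]_d :=
  [set y : 'rV[R]_d | forall i, `[x ord0 i - h, x ord0 i + h]%classic (y ord0 i)].

Let boxE x h (y : 'rV[R]_d) : 0 <= h -> box x h y <-> `|y - x| <= h.
Proof.
move=> h0; split=> [xy|yx i].
  by apply: mx_norm_le => // i; have := xy i; rewrite /= in_itv/= !mxE ler_distl.
have := le_trans (coord_le_mx_norm _ i) yx.
by rewrite /= in_itv/= !mxE ler_distl.
Qed.

Let measurable_box x h : measurable (box x h).
Proof.
rewrite (_ : box x h = \bigcap_(i in [set: 'I_d])
    ((fun y : 'rV[R]_d => y ord0 i) @^-1` `[x ord0 i - h, x ord0 i + h]%classic)).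
  rewrite bigcap_mkcond -[X in measurable X]setCK setC_bigcap.
  apply: measurableC; apply: countable_bigcupT_measurable => // i.
  rewrite in_setT; apply: measurableC; rewrite -[X in measurable X]setTI.
  apply: (@continuous_measurable_rV R d (fun y => y ord0 i)) => //.
  exact: coord_continuous.
by apply/seteqP; split => [y xy i _|y xy i]; exact: xy.
Qed.

Let lebesgue_boxE x h : 0 <= h -> lebesgue_rV (box x h) = ((2 * h) ^+ d)%:E.
Proof.
move=> h0; 
rewrite /box (lebesgue_rV_box
  (A := fun i => `[x ord0 i - h, x ord0 i + h]%classic))//.
rewrite (eq_bigr (fun=> (2 * h)%:E)); last first.
  move=> i _; rewrite lebesgue_measure_itv/= lte_fin.
  case: ltP => hx; last first.
    by congr EFin; apply/eqP; rewrite eq_le; apply/andP; split; lra.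
  by rewrite -EFinB; congr EFin; ring.
by rewrite prodEFin prodr_const card_ord.
Qed.

Lemma lebesgue_cball_lty x (rho : R) : (lebesgue_rV (cball N x rho) < +oo)%E.
Proof.
have [C C0 NC] := mx_norm_le_nrm hN.
apply: (@le_lt_trans _ _ (lebesgue_rV (box x (C * Num.max 0 rho)))).
  apply: le_measure; rewrite ?inE; [exact: measurable_cball|exact: measurable_box|].
  move=> y xy; apply/boxE; first by rewrite mulr_ge0 ?le_max ?lexx// ltW.
  apply: (le_trans (NC _)); rewrite ler_pM2l//.
  by apply: (le_trans xy); rewrite le_max lexx orbT.
by rewrite lebesgue_boxE ?ltry// mulr_ge0 ?le_max ?lexx// ltW.
Qed.

Lemma lebesgue_cball_ge : exists2 c : R, 0 < c & forall x (rho : R), 0 <= rho ->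
  ((c * rho `^ d%:R)%:E <= lebesgue_rV (cball N x rho))%E.
Proof.
have [C C0 NC] := nrm_le_mx_norm hN.
exists ((2 / C) ^+ d); first by rewrite exprn_gt0// divr_gt0.
move=> x rho rho0.
rewrite powR_mulrn// -exprMn -mulrA [_^-1 * _]mulrC -(lebesgue_boxE x); last first.
  by rewrite divr_ge0// ltW.
apply: le_measure; rewrite ?inE; [exact: measurable_box|exact: measurable_cball|].
move=> y /boxE xy; rewrite /cball/=; apply: (le_trans (NC _)).
by rewrite mulrC -ler_pdivlMr// xy// divr_ge0// ltW.
Qed.

End volume.

Section support.
Context (R : realType) (d : nat) (P : probability 'rV[R]_d R).

Let null_ball (p : 'rV[rat]_d * nat) : set 'rV[R]_d :=
  let B := ball (map_mx ratr p.1 : 'rV[R]_d) p.2.+1%:R^-1 in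
  if P B == 0%E then B else set0.

Let measurable_ball_rV (x : 'rV[R]_d) (e : R) : measurable (ball x e).
Proof. by apply: sub_sigma_algebra; exact: ball_open. Qed.

(** Second countability: a point outside the support lies in a null ball of the
    countable family of balls with a rational center and the inverse of a positive
    integer for radius. *)
Let setC_supp : ~` supp P = \bigcup_(p in [set: 'rV[rat]_d * nat]) null_ball p.
Proof.
apply/seteqP; split => [x|x [p _]].
  move=> /existsNP[U /not_implyP[oU /not_implyP[Ux /negP]]].
  rewrite -leNgt => PU.
  move: (Ux); rewrite {1}(open_bigcup_rat_ball oU) => -[p _ [pU px]].
  exists p => //; rewrite /null_ball ifT//.
  rewrite eq_le measure_ge0 andbT; apply: le_trans PU.
  apply: le_measure => //; rewrite inE; [exact: measurable_ball_rV|].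
  exact: sub_sigma_algebra.
rewrite /null_ball; case: ifPn => // /eqP PB px /(_ _ (ball_open _ _) px).
by rewrite PB ltxx.
Qed.

Let measurable_null_ball p : measurable (null_ball p).
Proof. by rewrite /null_ball; case: ifPn => // _; exact: measurable_ball_rV. Qed.

Lemma measurable_supp : measurable (supp P).
Proof.
rewrite -[supp P]setCK setC_supp; apply: measurableC.
by apply: countable_bigcupT_measurable => //; exact: countableP.
Qed.

Lemma probability_setC_supp : P (~` supp P) = 0%E.
Proof.
pose F (n : nat) := if @unpickle ('rV[rat]_d * nat)%type n is Some p
  then null_ball p else set0.
have PF n : P (F n) = 0%E.
  rewrite /F; case: unpickle => [p|]; last exact: measure0.
  by rewrite /null_ball; case: ifPn => [/eqP//|_]; exact: measure0.
apply/negligibleP; first by apply: measurableC; exact: measurable_supp.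
rewrite setC_supp; apply: (@negligibleS _ _ _ P (\bigcup_n F n)); last first.
  apply: negligible_bigcup => n; apply/negligibleP; last exact: PF.
  by rewrite /F; case: unpickle => [p|//]; exact: measurable_null_ball.
by move=> x [p _ px]; exists (pickle p) => //; rewrite /F pickleK.
Qed.

Lemma ae_supp : {ae P, forall x, supp P x}.
Proof.
exists (~` supp P); split=> //; first by apply: measurableC; exact: measurable_supp.
exact: probability_setC_supp.
Qed.

End support.

Section density.
Context (R : realType) (d : nat) (P : probability 'rV[R]_d R)
  (f : 'rV[R]_d -> R) (hPf : is_density P f).
Local Open Scope ereal_scope.

Lemma density_dominates : P `<< @lebesgue_rV R d.
Proof.
apply/null_content_dominatesP => A mA A0.
have [mf f0 Pf] := hPf; rewrite Pf//; apply: null_set_integral => //.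
exact/measurable_funTS/measurable_EFinP.
Qed.

(** A density agrees almost everywhere with the Radon-Nikodym derivative. *)
Lemma integral_density (g : 'rV[R]_d -> \bar R) :
  measurable_fun setT g -> (forall x, 0 <= g x) ->
  \int[P]_x g x = \int[@lebesgue_rV R d]_x (g x * (f x)%:E).
Proof.
move=> mg g0; have [mf f0 Pf] := hPf.
have mf' : measurable_fun setT (EFin \o f) by exact/measurable_EFinP.
have [h0 hi] := (Radon_Nikodym_SigmaFinite.f_ge0 density_dominates,
                 Radon_Nikodym_SigmaFinite.f_integrable density_dominates).
rewrite -(Radon_Nikodym_SigmaFinite.change_of_variables density_dominates)//.
have mh := measurable_int _ hi.
apply: ge0_ae_eq_integral => //.
- exact: emeasurable_funM.
- exact: emeasurable_funM.
- by move=> x _; rewrite mule_ge0.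
- by move=> x _; rewrite mule_ge0// lee_fin.
apply: ae_eqe_mul2l; apply: integral_ae_eq => // A _ mA.
rewrite -Pf//; apply/esym.
exact: (Radon_Nikodym_SigmaFinite.f_integral density_dominates).
Qed.

Lemma measurable_inv_powR (q : R) : measurable_fun setT (fun x => (f x `^ q)%:E^-1).
Proof.
have [mf f0 Pf] := hPf.
have mfp p : measurable_fun setT (fun x => f x `^ p)%R.
  by apply: (measurableT_comp (measurable_powR p)).
rewrite (_ : (fun x => _) = (fun x => if (f x `^ q == 0)%R then +oo
    else (f x `^ (- q))%:E)); last first.
  by apply/funext => x; rewrite inver powRN.
apply: measurable_fun_ifT => //; first exact: measurable_fun_eqr.
exact/measurable_EFinP.
Qed.

(** The change of measure multiplies the integrand by [f]: the points where [f]
    vanishes, at which the negative power is infinite, contribute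
    [+oo * 0 = 0]. *)
Lemma neg_moment_density (q : R) : (0 < q)%R ->
  neg_moment P f q =
  \int[@lebesgue_rV R d]_(x in [set x | 0 < f x]%R) (f x `^ (1 - q))%:E.
Proof.
move=> q0; have [mf f0 Pf] := hPf; rewrite /neg_moment integral_density.
- rewrite [RHS]integral_mkcond; apply: eq_integral => x _; rewrite patchE.
  case: ifPn => [|/negP]; rewrite inE /=.
    move=> fx0; rewrite inver gt_eqF ?powR_gt0//.
    rewrite -EFinM; congr EFin.
    by rewrite powRD ?(gt_eqF fx0) ?implybT// powRr1 ?ltW// powRN mulrC.
  move=> /negP; rewrite -leNgt => fx0.
  have -> : f x = 0%R by apply/eqP; rewrite eq_le fx0 f0.
  by rewrite mule0.
- exact: measurable_inv_powR.
- by move=> x; rewrite inve_ge0 lee_fin powR_ge0.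
Qed.

End density.

(** * Averaging over the center of the balls *)

Lemma measurable_sub_rV (R : realType) d :
  measurable_fun setT (fun p : 'rV[R]_d * 'rV[R]_d => p.2 - p.1).
Proof.
have mc i : measurable_fun setT (fun x : 'rV[R]_d => x ord0 i).
  by apply: continuous_measurable_rV; exact: coord_continuous.
pose t (p : 'rV[R]_d * 'rV[R]_d) : d.-tuple (measurableTypeR R) :=
  [tuple p.2 ord0 i - p.1 ord0 i | i < d].
rewrite (_ : (fun p => _) = @row_of_tuple R d \o t); last first.
  by apply/funext => p; apply/rowP => i; rewrite !mxE tnth_mktuple.
apply: (measurableT_comp (@measurable_row_of_tuple R d)).
apply/measurable_fun_tnthP => i.
apply: (eq_measurable_fun
    (fun p : 'rV[R]_d * 'rV[R]_d => p.2 ord0 i - p.1 ord0 i)).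
  by move=> p _; rewrite /= tnth_mktuple.
apply: measurable_funB; first exact: (measurableT_comp (mc i)).
exact: (measurableT_comp (mc i)).
Qed.

Section averaging.
Context (R : realType) (d : nat) (N : 'rV[R]_d -> R) (hN : is_norm N).
Context (P : probability 'rV[R]_d R) (A : set 'rV[R]_d) (A0 : A !=set0).
Context (r b : R).

Let u y := dist N y A.
Let near (p : 'rV[R]_d * 'rV[R]_d) : bool := N (p.2 - p.1) <= b * u p.1.

Let measurable_near : measurable [set p | near p].
Proof.
rewrite -[X in measurable X]setTI.
apply: (measurable_fun_le (D := setT) (f := fun p : 'rV[R]_d * 'rV[R]_d => N (p.2 - p.1))
  (g := fun p : 'rV[R]_d * 'rV[R]_d => b * u p.1)) => //.
  exact: (measurableT_comp (measurable_nrm hN) (@measurable_sub_rV R d)).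
apply: measurable_funM => //.
exact: (measurableT_comp (measurable_dist hN A0)).
Qed.

(** The bound on the [P]-mass of the balls centered at [y] is integrated over
    [y] and the order of integration is exchanged. Since [u] is Lipschitz, a
    given [x] belongs to the ball of every [y] in a ball centered at [x] of radius
    comparable with [u x], and there [u y] is comparable with [u x]. *)
Lemma averaging (c M M1 G : R) : 0 < r -> 0 < b < 1 / 2 -> 0 < c -> 0 <= G ->
  (forall x (rho : R), 0 <= rho ->
     ((c * rho `^ d%:R)%:E <= lebesgue_rV (cball N x rho))%E) ->
  (forall x, N x <= M -> N x + u x <= M1) ->
  (forall y, ((u y `^ r)%:E * P (cball N y (b * u y)) <= G%:E)%E) ->
  ((c * 2^-1 `^ r * (b / 2) `^ d%:R)%:E *
     \int[P]_(x in cball N 0 M) (u x `^ (d%:R + r))%:E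
   <= G%:E * lebesgue_rV (cball N 0 M1))%E.
Proof.
move=> r0 /andP[b0 b1] c0 G0 vol KK1 hG.
pose K1 := cball N 0 M1.
pose F (p : 'rV[R]_d * 'rV[R]_d) : \bar R :=
  (\1_K1 p.1 * u p.1 `^ r * \1_[set p | near p] p)%:E.
have F0 p : (0 <= F p)%E by rewrite lee_fin !mulr_ge0// powR_ge0.
have mF : measurable_fun setT F.
  apply/measurable_EFinP; apply: measurable_funM; last first.
    exact: measurable_indic.
  apply: measurable_funM.
    have mK1 : measurable_fun setT (\1_K1 : 'rV[R]_d -> R).
      by apply: measurable_indic; exact: measurable_cball.
    exact: (measurableT_comp mK1).
  apply: (measurableT_comp (measurable_powR r)).
  exact: (measurableT_comp (measurable_dist hN A0)).
have tonelli :=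
  fubini_tonelli (m1 := @lebesgue_rV R d) (m2 := P) F mF F0.
have nearE y x : \1_[set p | near p] (y, x) = \1_(cball N y (b * u y)) x :> R.
  by rewrite !indicE; congr ((nat_of_bool _)%:R); apply/idP/idP; rewrite !inE.
have ub : (\int[@lebesgue_rV R d]_y \int[P]_x F (y, x)
    <= G%:E * lebesgue_rV (cball N 0 M1))%E.
  rewrite -(integral_cst (@lebesgue_rV R d) (measurable_cball hN 0 M1)).
  rewrite [leRHS]integral_mkcond; apply: ge0_le_integral => //.
  - by move=> y _; exact: integral_ge0.
  - exact: (measurable_fun_fubini_tonelli_F (m2 := P)).
  - exact/(measurable_restrictT _ (measurable_cball hN 0 M1)).
  move=> y _; rewrite patchE; case: ifPn => yK1; last first.
    by rewrite integral0_eq// => x _; rewrite /F/= indicE (negbTE yK1) !mul0r.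
  apply: le_trans (hG y).
  have mB : measurable (cball N y (b * u y)) by exact: measurable_cball.
  under eq_integral do rewrite /F nearE/= indicE yK1 mul1r EFinM.
  rewrite ge0_integralZl_EFin//; last 2 first.
  - by apply/measurable_EFinP; exact: measurable_indic.
  - exact: powR_ge0.
  by rewrite integral_indic// setIT.
apply: le_trans ub; rewrite tonelli.
have mu s : measurable_fun setT (fun x => (u x `^ s)%:E).
  exact: (measurable_dist_powR hN s A0).
have const0 : 0 <= c * 2^-1 `^ r * (b / 2) `^ d%:R.
  by rewrite !mulr_ge0 ?powR_ge0// ltW.
rewrite -ge0_integralZl//; last 3 first.
- exact: measurable_cball.
- exact: measurable_funTS.
- by move=> x _; rewrite lee_fin powR_ge0.
rewrite integral_mkcond.
apply: ge0_le_integral => //.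
- by move=> x _; rewrite patchE; case: ifPn => // _; rewrite mule_ge0 ?lee_fin// powR_ge0.
- apply/(measurable_restrictT _ (measurable_cball hN 0 M)).
  by apply: measurable_funTS; exact: measurable_funeM.
- exact: (measurable_fun_fubini_tonelli_G (m1 := @lebesgue_rV R d)).
move=> x _; rewrite patchE; case: ifPn => [|_]; last exact: integral_ge0.
rewrite inE => Kx.
have ux0 : 0 <= u x by exact: dist_ge0.
have xM : N x <= M by move: Kx; rewrite /cball/= subr0.
pose B := cball N x (b / 2 * u x).
have mB : measurable B by exact: measurable_cball.
have mFx : measurable_fun setT (fun y => F (y, x)) by exact: measurable_fun_pair1.
apply: (@le_trans _ _ (\int[@lebesgue_rV R d]_(y in B) F (y, x))%E); last first.
  by apply: ge0_subset_integral.
apply: (@le_trans _ _ (\int[@lebesgue_rV R d]_(y in B) ((2^-1 * u x) `^ r)%:E)%E).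
  rewrite integral_cst//.
  apply: (@le_trans _ _ (((2^-1 * u x) `^ r)%:E * (c * (b / 2 * u x) `^ d%:R)%:E)%E).
    rewrite -!EFinM lee_fin !powRM ?divr_ge0 ?invr_ge0 ?(ltW b0)//.
    rewrite powRD; last by rewrite gt_eqF// ltr_wpDl.
    by rewrite le_eqVlt; apply/orP; left; apply/eqP; ring.
  rewrite lee_wpmul2l ?lee_fin ?powR_ge0//; apply: vol.
  by rewrite mulr_ge0// divr_ge0// ltW.
apply: ge0_le_integral => //.
- by move=> y _; rewrite lee_fin powR_ge0.
- exact: measurable_funTS.
move=> y; rewrite /B /cball/= => yx.
have xy := yx; rewrite (nrm_subC hN) in xy.
have uxy : u x - u y <= b / 2 * u x.
  by apply: le_trans xy; exact: dist_sub_le.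
have bu : b / 2 * u x <= 2^-1 * u x by rewrite ler_wpM2r//; lra.
have uyx : 2^-1 * u x <= u y by lra.
have yK1 : y \in K1.
  rewrite inE /K1 /cball/= subr0; apply: le_trans (KK1 _ xM).
  by have := nrm_sub_le hN y x; lra.
have yxb : x \in cball N y (b * u y).
  rewrite inE /cball/=; apply: (le_trans xy).
  by rewrite -mulrA ler_pM2l.
rewrite /F nearE/= !indicE yK1 yxb mul1r mulr1 lee_fin.
by apply: ge0_ler_powR; rewrite ?nnegrE ?(ltW r0)//; [rewrite mulr_ge0|exact: dist_ge0].
Qed.

End averaging.

(** * Exchanging one point of a quantizer *)

Lemma powRD_le (R : realType) (a b r : R) : 0 <= a -> 0 <= b -> 0 < r ->
  (a + b) `^ r <= 2 `^ r * (a `^ r + b `^ r).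
Proof.
move=> a0 b0 r0; wlog ab : a b a0 b0 / a <= b => [H|].
  have [/H|/ltW /H] := leP a b; first exact.
  by rewrite addrC [b `^ r + _]addrC; exact.
apply: (@le_trans _ _ ((2 * b) `^ r)).
  by apply: ge0_ler_powR; rewrite ?nnegrE ?(ltW r0) ?addr_ge0 ?mulr_ge0//; lra.
by rewrite powRM// ler_wpM2l ?powR_ge0// lerDr powR_ge0.
Qed.

Lemma card_le_seqP (T : choiceType) (A : set T) n : (A #<= `I_n)%card ->
  exists s : seq T, [/\ uniq s, (size s <= n)%N & A = [set` s]].
Proof.
move=> An; have fA : finite_set A by apply/finite_set_leP; exists n.
exists (finmap.enum_fset (fset_set A)); split.
- exact: finmap.fset_uniq.
- exact: geq_card_fset_set.
- by rewrite -[LHS](fset_setK fA).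
Qed.

Lemma card_seq_le (T : choiceType) (s : seq T) : ([set` s] #<= `I_(size s))%card.
Proof.
case: s => [|x0 s]; first by rewrite (_ : [set` _] = set0) ?card_ge0// -subset0.
apply: card_le_trans (card_image_le (fun i => nth x0 (x0 :: s) i) _).
apply: subset_card_le => x xs; exists (index x (x0 :: s)).
  by move: xs; rewrite /mkset -index_mem.
by rewrite nth_index.
Qed.

Lemma size_filter_notin (T : eqType) (s t : seq T) : uniq s ->
  (size s <= size [seq x <- s | x \notin t] + size t)%N.
Proof.
move=> us; rewrite -(count_predC [in t] s) addnC -!size_filter leq_add2l.
apply: uniq_leq_size; first exact: filter_uniq.
by move=> x; rewrite mem_filter => /andP[].
Qed.

Section exchange.
Context (R : realType) (d : nat) (N : 'rV[R]_d -> R) (hN : is_norm N).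
Context (P : probability 'rV[R]_d R) (r : R).

Lemma distortion_ge0 A : (0 <= distortion N P r A)%E.
Proof. by apply: integral_ge0 => x _; rewrite lee_fin powR_ge0. Qed.

(** Points of the ball are closer to [x] than to [A] by a fixed factor, so that
    adding [x] to [A] lowers the distortion there; on [W] the new quantizer [S]
    may be worse than [A], but its error is at most [h]. *)
Lemma exchange (A S W : set 'rV[R]_d) (h : 'rV[R]_d -> R) (b : R) x :
  0 < r -> 0 < b < 1 / 2 ->
  A !=set0 -> S x -> measurable W -> measurable_fun setT h ->
  (forall y, ~ W y -> dist N y S <= dist N y A) ->
  (forall y, W y -> dist N y S <= h y) ->
  (distortion N P r S +
     (((1 - b) `^ r - b `^ r) * dist N x A `^ r)%:E * P (cball N x (b * dist N x A))
   <= distortion N P r A + \int[P]_(y in W) (h y `^ r)%:E)%E.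
Proof.
move=> r0 /andP[b0 b1] A0 Sx mW mh SA Sh; set u := dist N x A.
set B := cball N x (b * u).
have u0 : 0 <= u by exact: dist_ge0.
have mB : measurable B by exact: measurable_cball.
have S0 : S !=set0 by exists x.
have bb : b `^ r <= (1 - b) `^ r.
  by apply: ge0_ler_powR; rewrite ?nnegrE ?(ltW r0)//; lra.
have g0 : 0 <= ((1 - b) `^ r - b `^ r) * u `^ r.
  by rewrite mulr_ge0 ?subr_ge0// powR_ge0.
rewrite -(integral_cst P mB) [X in (_ + X <= _)%E]integral_mkcond.
rewrite [X in (_ <= _ + X)%E]integral_mkcond.
have mhr : measurable_fun setT (fun y => (h y `^ r)%:E).
  by apply/measurable_EFinP; exact: (measurableT_comp (measurable_powR r)).
have mS := measurable_dist_powR hN r S0; have mA := measurable_dist_powR hN r A0.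
have mcB : measurable_fun setT
    ((cst (((1 - b) `^ r - b `^ r) * u `^ r)%:E : 'rV[R]_d -> \bar R) \_ B).
  exact/(measurable_restrictT _ mB).
have mhW : measurable_fun setT ((fun y => (h y `^ r)%:E) \_ W).
  by apply/(measurable_restrictT _ mW); exact: measurable_funTS.
have dist_powR_ge0 (Q : set 'rV[R]_d) y : setT y -> (0 <= (dist N y Q `^ r)%:E)%E.
  by rewrite lee_fin powR_ge0.
have cB0 y : setT y ->
    (0 <= ((cst (((1 - b) `^ r - b `^ r) * u `^ r)%:E : 'rV[R]_d -> \bar R) \_ B) y)%E.
  by rewrite patchE; case: ifPn => // _; rewrite lee_fin.
have hW0 y : setT y -> (0 <= ((fun y => (h y `^ r)%:E) \_ W) y)%E.
  by rewrite patchE; case: ifPn => // _; rewrite lee_fin powR_ge0.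
have addl := ge0_integralD P measurableT (dist_powR_ge0 S) mS cB0 mcB.
have addr := ge0_integralD P measurableT (dist_powR_ge0 A) mA hW0 mhW.
have eqW (a c : \bar R) : a = c -> (a <= c)%E by move=> ->.
apply: (le_trans (eqW _ _ (esym addl))); apply: (le_trans _ (eqW _ _ addr)).
apply: ge0_le_integral => //.
- move=> y _; rewrite patchE adde_ge0 ?lee_fin ?powR_ge0//.
  by case: ifPn => // _; rewrite lee_fin.
- exact: emeasurable_funD.
- exact: emeasurable_funD.
move=> y _; rewrite !patchE; case: ifPn => [/set_mem By|_].
  apply: (@le_trans _ _ (dist N y A `^ r)%:E); last first.
    by rewrite leeDl//; case: ifPn => // _; rewrite lee_fin powR_ge0.
  have yx : N (y - x) <= b * u := By.
  have xy := yx; rewrite (nrm_subC hN) in xy.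
  rewrite -EFinD lee_fin.
  have dS : dist N y S `^ r <= b `^ r * u `^ r.
    rewrite -powRM ?(ltW b0)//; apply: ge0_ler_powR; rewrite ?nnegrE ?(ltW r0)//.
    - exact: dist_ge0.
    - by rewrite mulr_ge0// ltW.
    - by apply: le_trans yx; exact: dist_le.
  have dA : (1 - b) `^ r * u `^ r <= dist N y A `^ r.
    have b1' : 0 <= 1 - b by lra.
    rewrite -powRM//; apply: ge0_ler_powR; rewrite ?nnegrE ?(ltW r0)//.
    - by rewrite mulr_ge0.
    - exact: dist_ge0.
    - by have := dist_sub_le hN x y A0; rewrite -/u; lra.
  by rewrite mulrBl; lra.
rewrite adde0; case: ifPn => [/set_mem Wy|/negP Wy].
  apply: (@le_trans _ _ (h y `^ r)%:E); last by rewrite leeDr// lee_fin powR_ge0.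
  rewrite lee_fin; apply: ge0_ler_powR; rewrite ?nnegrE ?(ltW r0) ?dist_ge0//.
  - by rewrite (le_trans (dist_ge0 hN y S))// Sh.
  - exact: Sh.
rewrite adde0 lee_fin; apply: ge0_ler_powR; rewrite ?nnegrE ?(ltW r0) ?dist_ge0//.
by apply: SA => yW; apply: Wy; rewrite inE.
Qed.

End exchange.

(** * Errors of optimal quantizers *)

(** The typical spacing of [n] points in dimension [d]. *)
Definition spacing (R : realType) (d n : nat) : R := n%:R `^ (- d%:R^-1).

Lemma spacing_gt0 (R : realType) d n : (1 <= n)%N -> 0 < spacing R d n.
Proof. by move=> n1; rewrite powR_gt0// ltr0n. Qed.

Lemma spacing_powRD (R : realType) d n (r : R) : (0 < d)%N -> (1 <= n)%N ->
  spacing R d n `^ (d%:R + r) = n%:R^-1 * spacing R d n `^ r.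
Proof.
move=> d0 n1; rewrite powRD; last by rewrite (gt_eqF (spacing_gt0 R d n1)) implybT.
by rewrite /spacing -[in LHS]powRrM mulNr mulVf ?pnatr_eq0 -?lt0n// powR_inv1.
Qed.

Section error_rate.
Context (R : realType) (d : nat) (d0 : (0 < d)%N) (N : 'rV[R]_d -> R)
  (hN : is_norm N) (P : probability 'rV[R]_d R) (r : R) (r0 : 0 < r)
  (theta : R) (theta0 : 0 < theta) (w : R)
  (hw : (\int[P]_x ((1 + N x) `^ ((1 + theta) * r))%:E <= w%:E)%E)
  (alpha : nat -> set 'rV[R]_d)
  (halpha : forall n : nat, (1 <= n)%N -> optimal_quantizer N P r n (alpha n)).

Let w0 : 0 <= w.
Proof.
by rewrite -lee_fin (le_trans _ hw)// integral_ge0// => x _; rewrite lee_fin powR_ge0.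
Qed.

Let alpha_neq0 n : (1 <= n)%N -> alpha n !=set0.
Proof. by move=> /halpha[]. Qed.

Let measurable_weight (s : R) : measurable_fun setT (fun x => ((1 + N x) `^ s)%:E).
Proof.
apply/measurable_EFinP; apply: (measurableT_comp (measurable_powR s)).
by apply: measurable_funD => //; exact: measurable_nrm.
Qed.

Let moment_nrm : (\int[P]_x (N x `^ r)%:E <= w%:E)%E.
Proof.
apply: le_trans hw; apply: ge0_le_integral => //.
- by move=> x _; rewrite lee_fin powR_ge0.
- exact: measurable_nrm_powR.
move=> x _; rewrite lee_fin; have N0 := nrm_ge0 hN x.
apply: (@le_trans _ _ ((1 + N x) `^ r)).
  by apply: ge0_ler_powR; rewrite ?nnegrE ?(ltW r0) ?addr_ge0 ?lerDr.
by apply: ler_powR; rewrite ?lerDl// mulrDl mul1r lerDl mulr_ge0// ltW.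
Qed.

Lemma distortion_le_moment n : (1 <= n)%N ->
  (distortion N P r (alpha n) <= w%:E)%E.
Proof.
move=> n1; have [_ _ opt] := halpha n1.
apply: (le_trans (opt [set 0] _ _)); first by exists 0.
  by rewrite (card_le_eql card_set1) card_le_II.
apply: le_trans moment_nrm; apply: ge0_le_integral => //.
- by move=> x _; rewrite lee_fin powR_ge0.
- by apply: measurable_dist_powR => //; exists 0.
- exact: measurable_nrm_powR.
move=> x _; rewrite lee_fin; apply: ge0_ler_powR; rewrite ?nnegrE ?(ltW r0)//.
- exact: dist_ge0.
- exact: nrm_ge0.
by have := dist_le hN x (A := [set 0]) (erefl 0); rewrite subr0.
Qed.

(** If all the points of an optimal quantizer were far from the origin, its error
    would exceed that of the quantizer reduced to the origin. *)
Lemma dist0_le : exists2 T : R, 0 <= T &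
  forall n, (1 <= n)%N -> dist N 0 (alpha n) <= T.
Proof.
exists ((2 `^ r * (w + w)) `^ r^-1); first exact: powR_ge0.
move=> n n1; have A0 := alpha_neq0 n1; have D0 := dist_ge0 hN 0 (alpha n).
have -> : dist N 0 (alpha n) = (dist N 0 (alpha n) `^ r) `^ r^-1.
  by rewrite -powRrM mulfV ?lt0r_neq0// powRr1.
apply: ge0_ler_powR; rewrite ?nnegrE ?invr_ge0 ?(ltW r0) ?powR_ge0//.
  by rewrite mulr_ge0 ?powR_ge0// addr_ge0.
rewrite -lee_fin -[leLHS]mule1 -(probability_setT P) -integral_cst//.
apply: (@le_trans _ _ (\int[P]_x ((2 `^ r)%:E *
    ((N x `^ r)%:E + (dist N x (alpha n) `^ r)%:E)))%E).
  apply: ge0_le_integral => //.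
  - by move=> x _; rewrite lee_fin powR_ge0.
  - apply: measurable_funeM; apply: emeasurable_funD.
      exact: measurable_nrm_powR.
    exact: measurable_dist_powR.
  move=> x _; rewrite /= -EFinD -EFinM lee_fin.
  apply: le_trans (powRD_le (nrm_ge0 hN x) (dist_ge0 hN x _) r0).
  apply: ge0_ler_powR; rewrite ?nnegrE ?(ltW r0) ?addr_ge0 ?nrm_ge0 ?dist_ge0//.
  by have := dist_sub_le hN 0 x A0; rewrite sub0r (nrmN hN); lra.
have m1 := measurable_nrm_powR hN r; have m2 := measurable_dist_powR hN r A0.
rewrite ge0_integralZl ?lee_fin ?powR_ge0//; last 2 first.
- exact: emeasurable_funD.
- by move=> x _; rewrite -EFinD lee_fin addr_ge0 ?powR_ge0.
rewrite EFinM lee_wpmul2l ?lee_fin ?powR_ge0// ge0_integralD//; last 2 first.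
- by move=> x _; rewrite lee_fin powR_ge0.
- by move=> x _; rewrite lee_fin powR_ge0.
by rewrite EFinD leeD// distortion_le_moment.
Qed.

(** Comparison with the cover of the whole space; the [r]-th power of its weight
    is the one whose integral is assumed to be finite. *)
Lemma distortion_le_rate : exists2 C : R, 0 < C & forall n, (1 <= n)%N ->
  (distortion N P r (alpha n) <= (C * spacing R d n `^ r)%:E)%E.
Proof.
have [C C0 cover] := weighted_cover theta0 hN d0.
exists (1 + w + C `^ r * w).
  by rewrite -addrA ltr_pwDl// addr_ge0// mulr_ge0 ?powR_ge0.
move=> n n1; case: (ltnP 1 n) => [n2|]; last first.
  move=> n1'; have -> : n = 1%N by apply/eqP; rewrite eqn_leq n1 n1'.
  apply: (le_trans (distortion_le_moment _)) => //.
  rewrite /spacing !powR1 mulr1 lee_fin.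
  by have := mulr_ge0 (powR_ge0 C r) w0; lra.
have [_ _ opt] := halpha n1.
have [|B [_ B0 [m mn Bm]] Bcov] := cover n setT n2; first by exists 0.
apply: (le_trans (opt B B0 _)).
  apply: (card_le_trans Bm); rewrite card_le_II (leq_trans _ mn)//.
  by rewrite leq_pmull.
apply: (@le_trans _ _ (\int[P]_x (((C * spacing R d n) `^ r)%:E *
    ((1 + N x) `^ ((1 + theta) * r))%:E))%E).
  apply: ge0_le_integral => //.
  - by move=> x _; rewrite lee_fin powR_ge0.
  - exact: measurable_dist_powR.
  - exact: measurable_funeM.
  move=> y _; rewrite -EFinM lee_fin powRrM -powRM; last 2 first.
  - by rewrite mulr_ge0 ?(ltW C0)// powR_ge0.
  - exact: powR_ge0.
  apply: ge0_ler_powR; rewrite ?nnegrE ?(ltW r0)//.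
  - exact: dist_ge0.
  - by rewrite !mulr_ge0 ?(ltW C0)// powR_ge0.
  have [//|z Bz yz] := Bcov y _.
  by apply: (le_trans (dist_le hN y Bz)).
rewrite ge0_integralZl ?lee_fin ?powR_ge0//; last by move=> y _; rewrite lee_fin powR_ge0.
apply: (@le_trans _ _ (((C * spacing R d n) `^ r)%:E * w%:E)%E).
  by rewrite lee_wpmul2l// lee_fin powR_ge0.
rewrite -EFinM lee_fin powRM ?(ltW C0) ?(ltW (spacing_gt0 _ _ n1))// mulrAC.
by rewrite ler_wpM2r ?powR_ge0// lerDr addr_ge0.
Qed.

End error_rate.

Section micro_macro.
Context (R : realType) (d : nat) (d0 : (0 < d)%N) (N : 'rV[R]_d -> R)
  (hN : is_norm N) (P : probability 'rV[R]_d R) (r : R) (r0 : 0 < r)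
  (theta : R) (theta0 : 0 < theta) (w : R)
  (hw : (\int[P]_x ((1 + N x) `^ ((1 + theta) * r))%:E <= w%:E)%E)
  (alpha : nat -> set 'rV[R]_d)
  (halpha : forall n : nat, (1 <= n)%N -> optimal_quantizer N P r n (alpha n)).

Let weight (y : 'rV[R]_d) : R := (1 + N y) `^ (1 + theta).

Let measurable_weight : measurable_fun setT weight.
Proof.
apply: (measurableT_comp (measurable_powR _)).
by apply: measurable_funD => //; exact: measurable_nrm.
Qed.

(** Bounds the error on the cell of a point after the removal of that point: the
    old error is increased by at most the distance from the point to its neighbour. *)
Let h (c : R) (n : nat) (y : 'rV[R]_d) : R :=
  dist N y (alpha n) + c * spacing R d n * weight y.

Let measurable_h c n : (1 <= n)%N -> measurable_fun setT (h c n).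
Proof.
move=> n1; apply: measurable_funD.
  by apply: measurable_dist => //; have [] := halpha n1.
by apply: measurable_funM => //.
Qed.

Let integral_h (c : R) : 0 <= c -> exists2 K : R, 0 < K & forall n, (1 <= n)%N ->
  (\int[P]_y (h c n y `^ r)%:E <= (K * spacing R d n `^ r)%:E)%E.
Proof.
move=> c0; have [D D0 HD] := distortion_le_rate d0 hN r0 theta0 hw halpha.
have w0 : 0 <= w.
  by rewrite -lee_fin (le_trans _ hw)// integral_ge0// => x _; rewrite lee_fin powR_ge0.
exists (2 `^ r * (D + c `^ r * w)).
  by rewrite mulr_gt0 ?powR_gt0// ltr_pwDl// mulr_ge0 ?powR_ge0.
move=> n n1; have A0 : alpha n !=set0 by have [] := halpha n1.
have nu0 := ltW (spacing_gt0 R d n1).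
have mw : measurable_fun setT (fun y => ((1 + N y) `^ ((1 + theta) * r))%:E).
  apply/measurable_EFinP; apply: (measurableT_comp (measurable_powR _)).
  by apply: measurable_funD => //; exact: measurable_nrm.
have mcw : measurable_fun setT (fun y => ((c * spacing R d n) `^ r)%:E *
    ((1 + N y) `^ ((1 + theta) * r))%:E)%E by exact: measurable_funeM.
have mA := measurable_dist_powR hN r A0.
have w1 y : setT y -> (0 <= ((1 + N y) `^ ((1 + theta) * r))%:E)%E.
  by rewrite lee_fin powR_ge0.
apply: (@le_trans _ _ (\int[P]_y ((2 `^ r)%:E *
    ((dist N y (alpha n) `^ r)%:E + ((c * spacing R d n) `^ r)%:E *
     ((1 + N y) `^ ((1 + theta) * r))%:E)))%E).
  apply: ge0_le_integral => //.
  - by move=> y _; rewrite lee_fin powR_ge0.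
  - apply/measurable_EFinP; apply: (measurableT_comp (measurable_powR r)).
    exact: measurable_h.
  - by apply: measurable_funeM; exact: emeasurable_funD.
  move=> y _; rewrite -EFinM lee_fin/= powRrM -powRM ?mulr_ge0 ?powR_ge0//.
  by apply: powRD_le => //; [exact: dist_ge0|rewrite !mulr_ge0 ?powR_ge0].
rewrite ge0_integralZl ?lee_fin ?powR_ge0//; last 2 first.
- exact: emeasurable_funD.
- by move=> y _; rewrite -EFinM -EFinD lee_fin addr_ge0 ?mulr_ge0 ?powR_ge0.
rewrite -mulrA EFinM lee_wpmul2l ?lee_fin ?powR_ge0// ge0_integralD//; last 2 first.
- by move=> y _; rewrite lee_fin powR_ge0.
- by move=> y _; rewrite -EFinM lee_fin mulr_ge0 ?powR_ge0.
rewrite [in leRHS]mulrDl EFinD leeD//; first exact: HD.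
rewrite ge0_integralZl ?lee_fin ?powR_ge0//.
apply: (@le_trans _ _ (((c * spacing R d n) `^ r)%:E * w%:E)%E).
  by rewrite lee_wpmul2l// lee_fin powR_ge0.
by rewrite -EFinM lee_fin powRM// mulrAC.
Qed.

(** Only the points of the strict Voronoi cell of [a] suffer from the removal of
    [a]. These cells are disjoint, and by the covering lemma applied to the
    quantizer itself at least half of its points have another point at a
    distance of the order of the spacing; the error on the cell of one
    of them is of the order of the average. *)
Lemma removable_point : exists2 K : R, 0 < K & forall n (s : seq 'rV[R]_d),
  (2 <= n)%N -> uniq s -> size s = n -> alpha n = [set` s] ->
  exists a (W : set 'rV[R]_d) (g : 'rV[R]_d -> R),
   [/\ a \in s, (alpha n `\ a) !=set0, measurable W /\ measurable_fun setT g,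
      forall y, (~ W y -> dist N y (alpha n `\ a) <= dist N y (alpha n)) /\
                (W y -> dist N y (alpha n `\ a) <= g y) &
      (\int[P]_(y in W) (g y `^ r)%:E <= (K * spacing R d n `^ (d%:R + r))%:E)%E].
Proof.
have [C C0 cover] := weighted_cover theta0 hN d0.
have [T T0 HT] := dist0_le hN r0 theta0 hw halpha.
pose c := C * (2 + T) `^ (1 + theta).
have c0 : 0 <= c by rewrite mulr_ge0 ?powR_ge0// ltW.
have [K K0 HK] := integral_h c0.
exists (4 * K); first exact: mulr_gt0.
move=> n s n2 us sn As; have n1 : (1 <= n)%N by exact: ltnW.
have A0 : alpha n !=set0 by have [] := halpha n1.
have Aa0 a : (alpha n `\ a) !=set0.
  rewrite As; move: us; case: s sn {As} => [|x [|y s]]; try by move=> sn0; rewrite -sn0 in n2.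
  move=> _ /=; rewrite inE negb_or => /andP[/andP[/eqP xy _] _].
  have [xa|/eqP xa] := eqVneq x a.
    by exists y; split; [rewrite /= !inE eqxx orbT|move=> yx; apply: xy; rewrite xa yx].
  by exists x; split; [rewrite /= !inE eqxx|].
pose W a := [set y | dist N y (alpha n) < dist N y (alpha n `\ a)].
have mW a : measurable (W a).
  rewrite (_ : W a = ~` (setT `&`
      [set y | dist N y (alpha n `\ a) <= dist N y (alpha n)])).
    by apply: measurableC; apply: measurable_fun_le => //; exact: measurable_dist.
  rewrite setTI; apply/seteqP; split => y; rewrite /W/= ltNge; first by move/negP.
  by move=> ?; exact/negP.
have Wuniq a a' y : W a y -> alpha n a' -> N (y - a') = dist N y (alpha n) -> a' = a.
  rewrite /W/= => Way Aa' ya'; apply: contrapT => a'a.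
  have /(dist_le hN y) : (alpha n `\ a) a' by [].
  by rewrite ya' => /(lt_le_trans Way); rewrite ltxx.
have nearest y : exists2 a', alpha n a' & N (y - a') = dist N y (alpha n).
  by apply: dist_attained => //; rewrite As.
have Wnear a y : W a y -> N (y - a) = dist N y (alpha n).
  by move=> Way; have [a' Aa' ya'] := nearest y; rewrite -(Wuniq _ _ _ Way Aa' ya').
have [B [BA B0 [m mn Bm]] Bcov] := cover n (alpha n) n2 A0.
have [t [ut st Bt]] := card_le_seqP Bm.
pose s' := [seq a <- s | a \notin t].
have s'n : (n <= 2 * size s')%N.
  have := size_filter_notin t us; rewrite -/s' sn => h1.
  rewrite -(leq_add2r (2 * m)) (leq_trans (leq_add (leqnn n) mn))//.
  by rewrite addnn -mul2n -mulnDr leq_mul// (leq_trans h1)// leq_add2l.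
have Wh a y : a \in s' -> W a y -> dist N y (alpha n `\ a) <= h c n y.
  rewrite mem_filter => /andP[at_ as_] Way; have yA := Wnear _ _ Way.
  have [|z Bz az] := Bcov a; first by rewrite As.
  have /(dist_le hN y) yz : (alpha n `\ a) z.
    split; first exact: BA.
    by move=> za; move: Bz; rewrite za Bt /= (negbTE at_).
  apply: (le_trans yz); apply: (le_trans (nrm_sub_triangle hN y a z)).
  rewrite yA lerD2l; apply: (le_trans az).
  have -> : c * spacing R d n * weight y =
      C * spacing R d n * ((2 + T) * (1 + N y)) `^ (1 + theta).
    by rewrite powRM ?addr_ge0 ?nrm_ge0// /c /weight; ring.
  rewrite ler_wpM2l ?mulr_ge0 ?powR_ge0 ?(ltW C0)//.
  have [Na0 Ny0] := (nrm_ge0 hN a, nrm_ge0 hN y).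
  apply: ge0_ler_powR; rewrite ?nnegrE.
  - by rewrite addr_ge0// ltW.
  - by rewrite addr_ge0.
  - by rewrite mulr_ge0// addr_ge0.
  have := nrm_sub_le hN a y; rewrite (nrm_subC hN) yA.
  have := dist_le_nrm hN y A0; have := HT n n1.
  have : 0 <= T * N y by rewrite mulr_ge0.
  lra.
have tW : trivIset [set` s'] W.
  move=> a a' _ _ [y [Way Wa'y]]; have [a1 Aa1 ya1] := nearest y.
  by rewrite -(Wuniq _ _ _ Way Aa1 ya1) (Wuniq _ _ _ Wa'y Aa1 ya1).
have mh : measurable_fun setT (fun y => (h c n y `^ r)%:E).
  apply/measurable_EFinP; apply: (measurableT_comp (measurable_powR r)).
  exact: measurable_h.
have sumle : (\sum_(a <- s') \int[P]_(y in W a) (h c n y `^ r)%:E <=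
    (K * spacing R d n `^ r)%:E)%E.
  apply: le_trans (HK n n1).
  have us' : uniq s' by exact: filter_uniq.
  rewrite -ge0_integral_bigsetU//; last 2 first.
  - exact: measurable_funTS.
  - by move=> y _; rewrite lee_fin powR_ge0.
  apply: ge0_subset_integral => //; last by move=> y _; rewrite lee_fin powR_ge0.
  by apply: bigsetU_measurable.
have nu0 := spacing_gt0 R d n1.
have [[a as' Ia]|none] := pselect (exists2 a, a \in s' &
    (\int[P]_(y in W a) (h c n y `^ r)%:E <=
     (4 * K * spacing R d n `^ (d%:R + r))%:E)%E).
  exists a, (W a), (h c n); split => //.
  - by move: as'; rewrite mem_filter => /andP[].
  - by split => //; exact: measurable_h.
  - move=> y; split; last exact: Wh.
    by rewrite /W/= => /negP; rewrite -leNgt.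
exfalso.
have : (\sum_(a <- s') (4 * K * spacing R d n `^ (d%:R + r))%:E <=
    \sum_(a <- s') \int[P]_(y in W a) (h c n y `^ r)%:E)%E.
  rewrite big_seq [leRHS]big_seq; apply: lee_sum => a as'.
  by rewrite leNgt; apply/negP => /ltW Ia; apply: none; exists a.
move=> /le_trans/(_ sumle); rewrite sumEFin lee_fin big_const_seq count_predT iter_addr_0.
rewrite spacing_powRD// -[_ *+ _]mulr_natr.
have : n%:R <= 2 * (size s')%:R :> R by rewrite -natrM ler_nat.
have nR : 0 < n%:R :> R by rewrite ltr0n.
have : 0 < K * spacing R d n `^ r by rewrite mulr_gt0// powR_gt0.
have -> : 4 * K * (n%:R^-1 * spacing R d n `^ r) * (size s')%:R =
  (K * spacing R d n `^ r) * (4 * (size s')%:R / n%:R) by ring.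
move: (K * _) => k k0 ns.
have : 2 <= 4 * (size s')%:R / n%:R :> R by rewrite ler_pdivlMr//; lra.
nra.
Qed.

(** Exchange of a removable point for [x]: by optimality the gain around [x] is
    at most the loss of the removal. *)
Lemma micro_macro (b : R) : 0 < b < 1 / 2 -> exists2 C : R, 0 < C &
  forall n x, (1 <= n)%N ->
  ((dist N x (alpha n) `^ r)%:E * P (cball N x (b * dist N x (alpha n))) <=
   (C * spacing R d n `^ (d%:R + r))%:E)%E.
Proof.
move=> b01; have [K K0 HK] := removable_point.
have g0 : 0 < (1 - b) `^ r - b `^ r.
  move: b01 => /andP[b0 b1]; rewrite subr_gt0; apply: gt0_ltr_powR; rewrite ?nnegrE//; lra.
have w0 : 0 <= w.
  by rewrite -lee_fin (le_trans _ hw)// integral_ge0// => x _; rewrite lee_fin powR_ge0.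
exists (((1 - b) `^ r - b `^ r)^-1 * (K + w)).
  by rewrite mulr_gt0 ?invr_gt0// ltr_pwDl.
move=> n x n1; set A := alpha n; set u := dist N x A; set B := cball N x (b * u).
have [A0 An opt] := halpha n1; rewrite -/A in A0 An opt.
have sp0 : 0 <= spacing R d n `^ (d%:R + r) by exact: powR_ge0.
suff gain : ((((1 - b) `^ r - b `^ r) * u `^ r)%:E * P B <=
    ((K + w) * spacing R d n `^ (d%:R + r))%:E)%E.
  rewrite -mulrA EFinM lee_pdivlMl// muleA -EFinM; exact: gain.
have gain0 : (0 <= (((1 - b) `^ r - b `^ r) * u `^ r)%:E * P B)%E.
  by rewrite mule_ge0// lee_fin mulr_ge0 ?powR_ge0// ltW.
have Aw := distortion_le_moment hN r0 theta0 hw halpha n1.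
have finish (S W : set 'rV[R]_d) (g : 'rV[R]_d -> R) : S x -> (S #<= `I_n)%card ->
    measurable W -> measurable_fun setT g ->
    (forall y, ~ W y -> dist N y S <= dist N y A) ->
    (forall y, W y -> dist N y S <= g y) ->
    (\int[P]_(y in W) (g y `^ r)%:E <= (K * spacing R d n `^ (d%:R + r))%:E)%E ->
    ((((1 - b) `^ r - b `^ r) * u `^ r)%:E * P B <=
    ((K + w) * spacing R d n `^ (d%:R + r))%:E)%E.
  move=> Sx Sn mW mg SA Sg Wg.
  have ex := exchange hN P r0 b01 A0 Sx mW mg SA Sg.
  have S0 : S !=set0 by exists x.
  have SI : (distortion N P r S <= w%:E + (K * spacing R d n `^ (d%:R + r))%:E)%E.
    apply: le_trans (leeD Aw Wg); apply: le_trans ex; by rewrite leeDl.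
  have Sfin : distortion N P r S \is a fin_num.
    rewrite ge0_fin_numE ?distortion_ge0//; apply: le_lt_trans SI _.
    by rewrite -EFinD ltry.
  have : (distortion N P r S + (((1 - b) `^ r - b `^ r) * u `^ r)%:E * P B <=
      distortion N P r S + (K * spacing R d n `^ (d%:R + r))%:E)%E.
    have e2 := leeD (opt S S0 Sn) Wg.
    have e3 := le_trans ex e2.
    exact: e3.
  rewrite leeD2lE// => /le_trans; apply.
  by rewrite lee_fin ler_wpM2r// lerDl.
have [s [us sn As]] := card_le_seqP An.
have addx : A `<=` [set` x :: s].
  by move=> y; rewrite As /= inE => ->; rewrite orbT.
have addxle y : ~ set0 y -> dist N y [set` x :: s] <= dist N y A.
  by move=> _; exact: dist_subset.
have xs : [set` x :: s] x by rewrite /= inE eqxx.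
have [sn'|ns] := ltnP (size s) n.
  apply: (finish [set` x :: s] set0 (cst 0)) => //.
  - by apply: (card_le_trans (card_seq_le _)); rewrite card_le_II.
  - by rewrite integral_set0 lee_fin mulr_ge0// ltW.
have {ns}sn : size s = n by apply/eqP; rewrite eqn_leq sn ns.
have [n2|n1'] := ltnP 1 n; last first.
  have n_eq1 : n = 1%N by apply/eqP; rewrite eqn_leq n1 n1'.
  have no0 y : set0 y -> dist N y [set` x :: s] <= (cst 0 : 'rV[R]_d -> R) y by [].
  have ex := exchange hN P r0 b01 A0 xs measurable0 (measurable_cst (0 : R)) addxle no0.
  apply: (@le_trans _ _ w%:E); last first.
    by rewrite n_eq1 /spacing !powR1 mulr1 lee_fin lerDr ltW.
  have DS := distortion_ge0 N P r [set` x :: s].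
  apply: (le_trans (leeDr _ DS)); apply: (le_trans ex).
  by rewrite integral_set0 adde0; exact: Aw.
have [a [W [g [sa Aa [mW mg] Wg Ig]]]] := HK n s n2 us sn As.
have AS : A `\ a `<=` [set` x :: rem a s].
  move=> y [Ay /eqP ya]; rewrite /= inE mem_rem_uniq// inE ya/=.
  by move: Ay; rewrite As /= => ->; rewrite orbT.
apply: (finish [set` x :: rem a s] W g) => //.
- by rewrite /= inE eqxx.
- by apply: (card_le_trans (card_seq_le _)); rewrite card_le_II /= size_rem// sn prednK.
- by move=> y Wy; apply: le_trans ((Wg y).1 Wy); exact: dist_subset.
- by move=> y Wy; apply: le_trans ((Wg y).2 Wy); exact: dist_subset.
Qed.

End micro_macro.

(** * Mass of small balls under the growth condition *)

Lemma kappa_ge (R : realType) d (N : 'rV[R]_d -> R) (hN : is_norm N)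
    (P : probability 'rV[R]_d R) : (0 < kappa N P)%E ->
  exists2 k : R, 0 < k & forall x (rho : R), supp P x -> 0 < rho ->
    (k%:E * lebesgue_rV (cball N x rho) <=
     lebesgue_rV (supp P `&` cball N x rho))%E.
Proof.
move=> kap.
have [k k0 kk] : exists2 k : R, 0 < k & (k%:E <= kappa N P)%E.
  move: kap; case: (kappa N P) => [a a0|_|//]; first by exists a.
  by exists 1; rewrite ?leey.
exists k => // x rho xP rho0; have [c c0 vol] := lebesgue_cball_ge hN.
have B0 : (0 < lebesgue_rV (cball N x rho))%E.
  by apply: lt_le_trans (vol x rho (ltW rho0)); rewrite lte_fin mulr_gt0// powR_gt0.
have Bfin : lebesgue_rV (cball N x rho) \is a fin_num.
  by rewrite ge0_fin_numE ?lebesgue_cball_lty// ltW.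
have : (k%:E <= lebesgue_rV (supp P `&` cball N x rho) / lebesgue_rV (cball N x rho))%E.
  by apply: (le_trans kk); apply: ereal_inf_lbound; exists x => //; exists rho.
move: B0; rewrite -(fineK Bfin) lte_fin => B0.
by rewrite inver gt_eqF// lee_pdivlMr.
Qed.

Section growth.
Context (R : realType) (d : nat) (N : 'rV[R]_d -> R) (hN : is_norm N)
  (P : probability 'rV[R]_d R) (f : 'rV[R]_d -> R) (hPf : is_density P f)
  (hkappa : (0 < kappa N P)%E).

(** On the part of the ball which lies in the support the density is bounded
    below by the growth condition, and that part fills a fixed fraction of the
    ball by the assumption on [kappa]. *)
Lemma growth_mass (eps : R) : growth_condition N P f eps ->
  exists M eta c : R, [/\ 0 < eta < 1 / 2, 0 < c &
    forall x (rho : R), supp P x -> M <= N x -> 0 < rho -> rho <= 2 * eta * N x ->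
      ((c * f x `^ (1 + eps) * rho `^ d%:R)%:E <= P (cball N x rho))%E].
Proof.
move=> [eta [M [C [eta01 M0 C0 grow]]]].
have [k k0 hk] := kappa_ge hN hkappa; have [c c0 vol] := lebesgue_cball_ge hN.
have [mf f0 Pf] := hPf.
exists M, eta, (C * k * c); split => //; first by rewrite !mulr_gt0.
move=> x rho xP Mx rho0 rhox; have mB := measurable_cball hN x rho.
have mS := @measurable_supp R d P.
have mSB : measurable (supp P `&` cball N x rho) by exact: measurableI.
have c1 : 0 <= C * f x `^ (1 + eps) by rewrite mulr_ge0 ?powR_ge0// ltW.
rewrite Pf//.
apply: (@le_trans _ _ 
  (\int[@lebesgue_rV R d]_(y in supp P `&` cball N x rho) (f y)%:E)%E); last first.
  apply: ge0_subset_integral => //.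
  - by apply/measurable_EFinP; exact: measurable_funTS.
  - by move=> y _; rewrite lee_fin.
apply: (@le_trans _ _ (\int[@lebesgue_rV R d]_(y in supp P `&` cball N x rho)
    (C * f x `^ (1 + eps))%:E)%E); last first.
  apply: ge0_le_integral => //.
  - by apply/measurable_EFinP; exact: measurable_funTS.
  - move=> y [yP xy]; rewrite lee_fin; apply: grow => //.
    exact: le_trans xy rhox.
rewrite integral_cst//.
apply: (@le_trans _ _ ((C * f x `^ (1 + eps))%:E * (k%:E * (c * rho `^ d%:R)%:E))%E).
  by rewrite -!EFinM lee_fin le_eqVlt; apply/orP; left; apply/eqP; ring.
rewrite lee_wpmul2l ?lee_fin//; apply: le_trans (hk x rho xP rho0).
by rewrite lee_wpmul2l ?lee_fin ?(ltW k0)//; apply: vol; exact: ltW.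
Qed.

End growth.

(** * Rates of convergence *)

Lemma powR_root_le (R : realType) (v k g p s : R) : 0 <= v -> 0 < k -> 0 < g ->
  0 < p -> 0 < s -> g * v `^ p <= k -> v `^ s <= k `^ (s / p) * (g `^ (s / p))^-1.
Proof.
move=> v0 k0 g0 p0 s0 gv; rewrite -powRN.
have -> : v `^ s = (v `^ p) `^ (s / p) by rewrite -powRrM mulrCA mulfV ?mulr1// gt_eqF.
rewrite powRN -ler_pdivrMr ?invr_gt0 ?powR_gt0// invrK mulrC -powRM ?powR_ge0 ?(ltW g0)//.
apply: ge0_ler_powR; rewrite ?nnegrE ?divr_ge0 ?(ltW s0) ?(ltW p0) ?(ltW k0)//.
by rewrite mulr_ge0 ?powR_ge0// ltW.
Qed.

Lemma weighted_moment (R : realType) d (N : 'rV[R]_d -> R) (hN : is_norm N)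
    (P : probability 'rV[R]_d R) (p : R) : 0 < p ->
  (\int[P]_x (N x `^ p)%:E < +oo)%E ->
  exists w : R, (\int[P]_x ((1 + N x) `^ p)%:E <= w%:E)%E.
Proof.
move=> p0 Np; have Np0 : (0 <= \int[P]_x (N x `^ p)%:E)%E.
  by apply: integral_ge0 => x _; rewrite lee_fin powR_ge0.
have mN := measurable_nrm_powR hN p.
exists (2 `^ p * (1 + fine (\int[P]_x (N x `^ p)%:E))).
rewrite EFinM EFinD fineK ?ge0_fin_numE//.
apply: (@le_trans _ _ (\int[P]_x ((2 `^ p)%:E * (1%:E + (N x `^ p)%:E)))%E).
  apply: ge0_le_integral => //.
  - by move=> x _; rewrite lee_fin powR_ge0.
  - apply/measurable_EFinP; apply: (measurableT_comp (measurable_powR p)).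
    by apply: measurable_funD => //; exact: measurable_nrm.
  - by apply: measurable_funeM; exact: emeasurable_funD.
  move=> x _; rewrite -EFinD -EFinM lee_fin.
  have := powRD_le ler01 (nrm_ge0 hN x) p0; rewrite powR1; exact.
rewrite ge0_integralZl ?lee_fin ?powR_ge0//; last 2 first.
- exact: emeasurable_funD.
- by move=> x _; rewrite -EFinD lee_fin addr_ge0 ?powR_ge0.
rewrite lee_wpmul2l ?lee_fin ?powR_ge0// ge0_integralD//; last first.
  by move=> x _; rewrite lee_fin powR_ge0.
have := integral_cst P measurableT 1%E; rewrite mul1e => ->.
exact: leeD (probability_le1 P measurableT) (lexx _).
Qed.

Section rate.
Context (R : realType) (d : nat) (d0 : (0 < d)%N) (N : 'rV[R]_d -> R)
  (hN : is_norm N) (P : probability 'rV[R]_d R) (r : R) (r0 : 0 < r)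
  (f : 'rV[R]_d -> R) (hPf : is_density P f)
  (theta : R) (theta0 : 0 < theta) (w : R)
  (hw : (\int[P]_x ((1 + N x) `^ ((1 + theta) * r))%:E <= w%:E)%E)
  (alpha : nat -> set 'rV[R]_d)
  (halpha : forall n : nat, (1 <= n)%N -> optimal_quantizer N P r n (alpha n))
  (hkappa : (0 < kappa N P)%E).

Let v n x : R := dist N x (alpha n) / spacing R d n.

Let v_ge0 n x : 0 <= v n x.
Proof. by rewrite divr_ge0 ?dist_ge0// powR_ge0. Qed.

Let measurable_v n (s : R) : (1 <= n)%N ->
  measurable_fun setT (fun x => (v n x `^ s)%:E).
Proof.
move=> n1; apply/measurable_EFinP; apply: (measurableT_comp (measurable_powR s)).
apply: measurable_funM => //; apply: measurable_dist => //.
by have [] := halpha n1.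
Qed.

(** On a bounded set the micro-macro inequality is averaged over the centers,
    for any fixed ratio [b] between the radius and the distance to the quantizer,
    here 1 / 4. The resulting moment has order [d + r]. *)
Lemma compact_rate (M : R) : exists2 C : R, 0 <= C & forall n, (1 <= n)%N ->
  (\int[P]_(x in cball N 0 M) (v n x `^ (d%:R + r))%:E <= C%:E)%E.
Proof.
have b01 : (0 < (1 / 4 : R)) && ((1 / 4 : R) < 1 / 2) by apply/andP; split; lra.
have [C C0 HC] := micro_macro d0 hN r0 theta0 hw halpha b01.
have [T T0 HT] := dist0_le hN r0 theta0 hw halpha.
have [c c0 vol] := lebesgue_cball_ge hN.
pose L := fine (lebesgue_rV (cball N 0 (2 * M + T))).
have LE : lebesgue_rV (cball N 0 (2 * M + T)) = L%:E.
  by rewrite fineK// ge0_fin_numE// lebesgue_cball_lty.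
have L0 : 0 <= L by rewrite fine_ge0.
pose c' := c * 2^-1 `^ r * (1 / 4 / 2) `^ d%:R.
have c'0 : 0 < c' by rewrite !mulr_gt0 ?powR_gt0//; lra.
exists (c'^-1 * (C * L)); first by rewrite !mulr_ge0 ?invr_ge0// ltW.
move=> n n1; have [A0 _ _] := halpha n1.
have sp0 := spacing_gt0 R d n1.
have spp : 0 < spacing R d n `^ (d%:R + r) by rewrite powR_gt0.
have mu := measurable_dist_powR hN (d%:R + r) A0.
have mK := measurable_cball hN 0 M.
have -> : (\int[P]_(x in cball N 0 M) (v n x `^ (d%:R + r))%:E =
    ((spacing R d n `^ (d%:R + r))^-1)%:E *
     \int[P]_(x in cball N 0 M) (dist N x (alpha n) `^ (d%:R + r))%:E)%E.
  rewrite -ge0_integralZl//; last 3 first.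
  - exact: measurable_funTS.
  - by move=> x _; rewrite lee_fin powR_ge0.
  - by rewrite lee_fin invr_ge0 powR_ge0.
  apply: eq_integral => x _; rewrite -EFinM; congr EFin.
  rewrite /v powRM ?dist_ge0 ?invr_ge0 ?(ltW sp0)// mulrC; congr (_ * _).
  by rewrite -[(spacing R d n)^-1]powR_inv1 ?(ltW sp0)// -powRrM mulN1r powRN.
have G0 : 0 <= C * spacing R d n `^ (d%:R + r) by rewrite mulr_ge0// ltW.
have KK1 x : N x <= M -> N x + dist N x (alpha n) <= 2 * M + T.
  by move=> xM; have := dist_le_nrm hN x A0; have := HT n n1; lra.
have := averaging hN A0 r0 b01 c0 G0 vol KK1 (fun y => HC n y n1).
rewrite LE -EFinM -/c' -lee_pdivlMl// => /le_trans av.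
rewrite lee_pdivrMl//; apply: av.
by rewrite -!EFinM lee_fin le_eqVlt; apply/orP; left; apply/eqP; ring.
Qed.

(** Far away the growth condition turns the micro-macro inequality into a
    pointwise bound by a negative power of the density. *)
Lemma tail_bound (eps s : R) : 0 <= eps -> growth_condition N P f eps -> 0 < s ->
  exists M C : R, 0 < C /\ forall n x, (1 <= n)%N -> supp P x -> M <= N x ->
    ((v n x `^ s)%:E <= C%:E * (f x `^ (s * (1 + eps) / (d%:R + r)))%:E^-1)%E.
Proof.
move=> eps0 /(growth_mass hN hPf hkappa)[M0 [eta [c [eta01 c0 mass]]]] s0.
have [C C0 HC] := micro_macro d0 hN r0 theta0 hw halpha eta01.
have [T T0 HT] := dist0_le hN r0 theta0 hw halpha.
have [mf f0 Pf] := hPf; have /andP[eta0 eta1] := eta01.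
have dr0 : 0 < d%:R + r by rewrite ltr_wpDl.
have c1 : 0 < c * eta `^ d%:R by rewrite mulr_gt0// powR_gt0.
exists (Num.max M0 T), ((C / (c * eta `^ d%:R)) `^ (s / (d%:R + r))).
split; first by rewrite powR_gt0// divr_gt0.
move=> n x n1 xP; rewrite ge_max => /andP[M0x Tx].
have [A0 _ _] := halpha n1; have sp0 := spacing_gt0 R d n1.
have K0 : 0 < (C / (c * eta `^ d%:R)) `^ (s / (d%:R + r)) by rewrite powR_gt0// divr_gt0.
have [fx0|fx0] := eqVneq (f x) 0.
  have q0 : s * (1 + eps) / (d%:R + r) != 0.
    by rewrite gt_eqF// divr_gt0// mulr_gt0// ltr_pwDl.
  by rewrite fx0 powR0// inve0 gt0_muley ?leey.
have {}fx0 : 0 < f x by rewrite lt_neqAle eq_sym fx0 f0.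
rewrite inver gt_eqF ?powR_gt0// -EFinM lee_fin.
have -> : f x `^ (s * (1 + eps) / (d%:R + r)) = (f x `^ (1 + eps)) `^ (s / (d%:R + r)).
  by rewrite -powRrM; congr (_ `^ _); ring.
have [u0|un0] := eqVneq (dist N x (alpha n)) 0.
  rewrite /v u0 mul0r powR0 ?gt_eqF// mulr_ge0 ?invr_ge0 ?powR_ge0//.
have u0 : 0 < dist N x (alpha n) by rewrite lt_neqAle eq_sym un0 dist_ge0.
apply: powR_root_le => //.
- by rewrite divr_gt0.
- by rewrite powR_gt0.
rewrite /v powRM ?invr_ge0 ?(ltW u0) ?(ltW sp0)//.
rewrite -[(spacing R d n)^-1]powR_inv1 ?(ltW sp0)// -powRrM mulN1r powRN.
rewrite mulrA ler_pdivrMr ?(powR_gt0 _ sp0)// mulrAC ler_pdivlMr//.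
have ux : dist N x (alpha n) <= 2 * N x.
  by have := dist_le_nrm hN x A0; have := HT n n1; lra.
have rho0 : 0 < eta * dist N x (alpha n) by rewrite mulr_gt0.
have rhox : eta * dist N x (alpha n) <= 2 * eta * N x.
  by rewrite mulrAC [2 * _ * _]mulrC ler_pM2l// mulrC.
have := HC n x n1.
have := mass x _ xP M0x rho0 rhox.
have up : (0 <= (dist N x (alpha n) `^ r)%:E)%E by rewrite lee_fin powR_ge0.
move=> /(lee_wpmul2l up)/le_trans/[apply].
rewrite -EFinM lee_fin; apply: le_trans.
have -> : dist N x (alpha n) `^ (d%:R + r) =
    dist N x (alpha n) `^ d%:R * dist N x (alpha n) `^ r.
  by rewrite powRD// (gt_eqF dr0).
rewrite [(eta * _) `^ _]powRM ?(ltW u0) ?(ltW eta0)//.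
by rewrite le_eqVlt; apply/orP; left; apply/eqP; ring.
Qed.

Let distortion_v n (s : R) : (1 <= n)%N ->
  ((n%:R `^ (s / d%:R))%:E * distortion N P s (alpha n) =
   \int[P]_x (v n x `^ s)%:E)%E.
Proof.
move=> n1; have sp0 := spacing_gt0 R d n1; have [A0 _ _] := halpha n1.
have D0 x : setT x -> (0 <= (dist N x (alpha n) `^ s)%:E)%E.
  by rewrite lee_fin powR_ge0.
have c0 : (0 <= (n%:R `^ (s / d%:R))%:E :> \bar R)%E by rewrite lee_fin powR_ge0.
rewrite /distortion -(ge0_integralZl P measurableT (measurable_dist_powR hN s A0) D0 c0).
apply: eq_integral => x _; rewrite -EFinM; congr EFin.
rewrite /v powRM ?dist_ge0 ?invr_ge0 ?(ltW sp0)// mulrC; congr (_ * _).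
by rewrite /spacing powRN invrK -powRrM mulrC.
Qed.

(** On the ball [K] the power [s] is bounded by 1 plus the power [d + r]; outside
    of it the pointwise bound is integrated. *)
Lemma growth_rate (eps s : R) : 0 <= eps -> growth_condition N P f eps ->
  0 < s < d%:R + r -> (neg_moment P f (s * (1 + eps) / (d%:R + r)) < +oo)%E ->
  rate_bound N P alpha s.
Proof.
move=> eps0 grow /andP[s0 sdr] Qoo.
have [M [C2 [C20 tail]]] := tail_bound eps0 grow s0.
have [C1 C10 comp] := compact_rate M.
set q := s * (1 + eps) / (d%:R + r) in Qoo tail.
have finv0 x : (0 <= (f x `^ q)%:E^-1)%E by rewrite inve_ge0 lee_fin powR_ge0.
have mfinv := measurable_inv_powR hPf q.
have Q0 : (0 <= neg_moment P f q)%E by apply: integral_ge0 => x _; exact: finv0.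
pose K := cball N 0 M; have mK : measurable K by exact: measurable_cball.
apply: (@le_lt_trans _ _ (1 + C1%:E + C2%:E * neg_moment P f q)%E); last first.
  by rewrite -(fineK (_ : neg_moment P f q \is a fin_num)) ?ge0_fin_numE// -EFinM -!EFinD ltry.
apply: ge_ereal_sup => _ [n /= n1 <-]; rewrite distortion_v//.
pose F1 := (fun x => 1%:E + (v n x `^ (d%:R + r))%:E)%E \_ K.
pose F2 x := (C2%:E * (f x `^ q)%:E^-1)%E.
have mv s' := measurable_v s' n1.
have mF1 : measurable_fun setT F1.
  apply/(measurable_restrictT _ mK); apply: measurable_funTS.
  by apply: emeasurable_funD.
have mF2 : measurable_fun setT F2 by exact: measurable_funeM.
have v1 x : K x -> (0 <= 1%:E + (v n x `^ (d%:R + r))%:E)%E.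
  by move=> _; rewrite -EFinD lee_fin addr_ge0 ?powR_ge0.
have F10 x : setT x -> (0 <= F1 x)%E.
  by move=> _; rewrite /F1 patchE; case: ifPn => // /set_mem; exact: v1.
have F20 x : setT x -> (0 <= F2 x)%E by move=> _; rewrite mule_ge0// lee_fin ltW.
apply: (@le_trans _ _ (\int[P]_x (F1 x + F2 x))%E).
  apply: ae_ge0_le_integral => //.
  - by move=> x _; rewrite lee_fin powR_ge0.
  - by move=> x _; rewrite adde_ge0 ?F10 ?F20.
  - exact: emeasurable_funD.
  apply: filterS (ae_supp P) => x xP _.
  have [xK|/negP xK] := boolP (x \in K).
    apply: (@le_trans _ _ (F1 x)); last by rewrite leeDl ?F20.
    rewrite /F1 patchE xK -EFinD lee_fin.
    have [v_le1|/ltW v_ge1] := leP (v n x) 1.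
      apply: (@le_trans _ _ 1); last by rewrite lerDl powR_ge0.
      by have := ge0_ler_powR (ltW s0) (v_ge0 n x) (ler01 : 1 \is Num.nneg) v_le1;
        rewrite powR1.
    apply: (@le_trans _ _ (v n x `^ (d%:R + r))); last by rewrite lerDr.
    by apply: ler_powR => //; exact: ltW.
  apply: (@le_trans _ _ (F2 x)); last by rewrite leeDr ?F10.
  apply: tail => //; rewrite leNgt; apply/negP => xM; apply: xK.
  by rewrite inE /K /cball/= subr0 ltW.
have -> : (\int[P]_x (F1 x + F2 x) = \int[P]_x F1 x + \int[P]_x F2 x)%E.
  exact: ge0_integralD.
apply: leeD; last by rewrite /F2 ge0_integralZl// lee_fin ltW.
rewrite /F1 -integral_mkcond.
have -> : (\int[P]_(x in K) (1%:E + (v n x `^ (d%:R + r))%:E) =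
    \int[P]_(x in K) 1%:E + \int[P]_(x in K) (v n x `^ (d%:R + r))%:E)%E.
  apply: ge0_integralD => //.
  - by move=> x _; rewrite lee_fin powR_ge0.
  - exact: measurable_funTS.
apply: leeD; last exact: comp.
rewrite (integral_cst P mK 1%E) mul1e; exact: probability_le1.
Qed.

End rate.

Theorem corollary4 (R : realType) (d : nat) (hd : (1 <= d)%N)
    (N : 'rV[R]_d -> R) (hN : is_norm N)
    (r : R) (hr : 0 < r)
    (P : probability 'rV[R]_d R) (f : 'rV[R]_d -> R) (hPf : is_density P f)
    (hmoment : exists2 delta : R, 0 < delta &
       (\int[P]_x (N x `^ (r + delta))%:E < +oo)%E)
    (alpha : nat -> set 'rV[R]_d)
    (halpha : forall n : nat, (1 <= n)%N -> optimal_quantizer N P r n (alpha n))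
    (hkappa : (0 < kappa N P)%E) :
  (forall eps : R, 0 <= eps -> growth_condition N P f eps ->
     forall s : R, r < s < (d%:R + r) / (1 + eps) ->
       (neg_moment P f (s * (1 + eps) / (d%:R + r)) < +oo)%E ->
       rate_bound N P alpha s) /\
  (forall s : R, r < s < d%:R + r ->
     neg_moment P f (s / (d%:R + r)) =
     (\int[@lebesgue_rV R d]_(x in [set x | 0 < f x]%R)
        (f x `^ (1 - s / (d%:R + r)))%:E)%E) /\
  (growth_condition N P f 0 \/
   (exists2 eps0 : R, 0 < eps0 &
      forall eps : R, 0 < eps <= eps0 -> growth_condition N P f eps) ->
   (forall s : R, r < s < d%:R + r ->
      (neg_moment P f (s / (d%:R + r)) < +oo)%E) ->
   forall s : R, r < s < d%:R + r -> rate_bound N P alpha s).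
Proof.
have [delta delta0 moment] := hmoment.
have dr0 : 0 < d%:R + r by rewrite ltr_wpDl.
have theta0 : 0 < delta / r by exact: divr_gt0.
have [w hw] : exists w : R,
    (\int[P]_x ((1 + N x) `^ ((1 + delta / r) * r))%:E <= w%:E)%E.
  have -> : (1 + delta / r) * r = r + delta by field; rewrite gt_eqF.
  by apply: weighted_moment => //; exact: addr_gt0.
have rate := growth_rate hd hN hr hPf theta0 hw halpha hkappa.
split; [|split].
- move=> eps eps0 grow s /andP[rs sd] mom; apply: (rate eps) => //.
  rewrite (lt_trans hr rs)/= (lt_le_trans sd)// ler_pdivrMr ?ltr_pwDl//.
  by rewrite ler_peMr ?lerDl// ltW.
- move=> s /andP[rs sd]; apply: neg_moment_density => //.
  by rewrite divr_gt0// (lt_trans hr rs).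
- move=> grow mom s /andP[rs sd]; have s0 := lt_trans hr rs.
  have sdr : 0 < s < d%:R + r by rewrite s0.
  case: grow => [grow0|[eps0 eps00 grow]].
    apply: (rate 0) => //; rewrite addr0 mulr1; apply: mom.
    by rewrite rs.
  (* s (1 + eps) uses up at most half of the gap between s and d + r, which keeps
     the inequality with d + r strict *)
  pose eps := Num.min eps0 ((d%:R + r - s) / (2 * s)).
  have epsgt0 : 0 < eps by rewrite lt_min eps00 divr_gt0 ?mulr_gt0// subr_gt0.
  have epsle : eps <= (d%:R + r - s) / (2 * s) by rewrite ge_min lexx orbT.
  apply: (rate eps) => //; [exact: ltW| |apply: mom].
    by apply: grow; rewrite epsgt0 ge_min lexx.
  move: epsle; rewrite ler_pdivlMr ?mulr_gt0// => epsle.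
  have es0 : 0 < eps * s by rewrite mulr_gt0.
  by apply/andP; split; lra.
Qed.
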